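(* Let $\varphi,\chi\in\mathcal C^1(0,+\infty)$. Then $(\varphi,\chi)$ induces a paired monotone metric if and only if (pairs being considered up to equivalence) one of the following two possibilities holds: $$(\varphi(x),\chi(x))=\left(\frac{x^p}{p},\frac{x^{1-p}}{1-p}\right)\quad\text{with } p\in[-1,2]\setminus\{0,1\},$$ $$(\varphi(x),\chi(x))=(x,\log x).$$
   Context: $M_n$ is the space of $n\times n$ complex matrices and $\mathcal D^1_n$ is the manifold of density matrices, i.e. strictly positive elements of $M_n$ with trace $1$; its tangent space at $\rho$ is $T_\rho\mathcal D^1_n=\{A\in M_n: A=A^*,\ \mathrm{Tr}(A)=0\}$. A real function $\varphi\in\mathcal C^1(0,+\infty)$ is regarded, via functional calculus, as a map $\rho\mapsto\varphi(\rho)$ from $\mathcal D^1_n$ to $M_n$, with differential $D_\rho\varphi$ at $\rho$. A function $f:(0,\infty)\to\mathbb R$ is operator monotone if for every $n$ and all $A,B\in M_n$ with $0\le A\le B$ one has $0\le f(A)\le f(B)$. It is symmetric if $f(x)=xf(x^{-1})$ for all $x>0$, and normalised if $f(1)=1$. The associated Chentsov--Morotzova function is $c_f(x,y)=\frac{1}{y f(xy^{-1})}$, $x,y>0$. With $L_\rho(A)=\rho A$ and $R_\rho(A)=A\rho$ (commuting operators), $c_f(L_\rho,R_\rho)$ is defined by functional calculus: if $\rho=\sum_i\lambda_iE_i$ is the spectral decomposition, then $c_f(L_\rho,R_\rho)(B)=\sum_{i,j}c_f(\lambda_i,\lambda_j)E_iBE_j$. The pair $(\varphi,\chi)$ induces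 a paired monotone metric if there exists a normalised symmetric operator monotone function $f$ such that for all $n$, all $\rho\in\mathcal D^1_n$ and all $A,B\in T_\rho\mathcal D^1_n$, $$\mathrm{Tr}\big(D_\rho\varphi(A)\, D_\rho\chi(B)\big)=\mathrm{Tr}\big(A\, c_f(L_\rho,R_\rho)(B)\big).$$ Two pairs $(\varphi,\chi)$ and $(\tilde\varphi,\tilde\chi)$ are equivalent if there exist constants $A_1,A_2,B_1,B_2$ with $A_1A_2=1$, $\tilde\varphi=A_1\varphi+B_1$ and $\tilde\chi=A_2\chi+B_2$.
   Formalization: Equivalence of pairs is required only on (0,1], where spectra of density matrices lie, since values on (1,∞) do not affect the metric; and the pair (x, log x) is allowed in either order, because (log x, x) induces the same metric but is not equivalent to a listed pair. *)

(* Defs.v *)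
From HB Require Import structures.
From mathcomp Require Import all_boot all_order all_algebra.
From mathcomp Require Import complex.
From mathcomp Require Import all_classical all_reals all_analysis.

Set Implicit Arguments.
Unset Strict Implicit.
Unset Printing Implicit Defensive.

Import Order.TTheory GRing.Theory Num.Theory.
Import numFieldNormedType.Exports.

Local Open Scope ring_scope.
Local Open Scope classical_set_scope.
Local Open Scope complex_scope.
Local Open Scope sesquilinear_scope.

(* The order on [R[i]] makes [0 < z] and [0 <= z] include that z is real. *)
Definition posdefmx (R : realType) (n : nat) (M : 'M[R[i]]_n) : Prop :=
  M \is hermsymmx /\
  forall v : 'rV[R[i]]_n, v != 0 -> 0 < (v *m M *m v ^t*) 0 0.

Definition possemidefmx (R : realType) (n : nat) (M : 'M[R[i]]_n) : Prop :=
  M \is hermsymmx /\ forall v : 'rV[R[i]]_n, 0 <= (v *m M *m v ^t*) 0 0.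

Definition density (R : realType) (n : nat) (rho : 'M[R[i]]_n) : Prop :=
  posdefmx rho /\ \tr rho = 1.

Definition tangent (R : realType) (n : nat) (M : 'M[R[i]]_n) : Prop :=
  M \is hermsymmx /\ \tr M = 0.

(* For Hermitian M, the family (speceig M i, specproj M i)_i is a spectral
   decomposition of M into rank-one orthogonal projections: eigenvalues are
   repeated with multiplicity. *)
Definition speceig (R : realType) (n : nat) (M : 'M[R[i]]_n) (i : 'I_n) : R :=
  complex.Re (spectral_diag M 0 i).

Definition specproj (R : realType) (n : nat) (M : 'M[R[i]]_n) (i : 'I_n) :
    'M[R[i]]_n :=
  invmx (spectralmx M) *m delta_mx i i *m spectralmx M.

Definition mxfun (R : realType) (phi : R -> R) (n : nat) (M : 'M[R[i]]_n) :
    'M[R[i]]_n :=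
  \sum_(i < n) (phi (speceig M i))%:C *: specproj M i.

(* c(L_rho, R_rho)(B), for c : (0,+oo)^2 -> R *)
Definition mxfunLR (R : realType) (c : R -> R -> R) (n : nat)
    (rho B : 'M[R[i]]_n) : 'M[R[i]]_n :=
  \sum_(i < n) \sum_(j < n) (c (speceig rho i) (speceig rho j))%:C *:
    (specproj rho i *m B *m specproj rho j).

(* f is only meaningful on (0,+oo), so f(M) requires M to be strictly
   positive; N >= M is then strictly positive as well. *)
Definition operator_monotone (R : realType) (f : R -> R) : Prop :=
  forall (n : nat) (M N : 'M[R[i]]_n),
    posdefmx M -> possemidefmx (N - M) ->
    possemidefmx (mxfun f M) /\ possemidefmx (mxfun f N - mxfun f M).

Definition symmetric_fun (R : realType) (f : R -> R) : Prop :=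
  forall x : R, 0 < x -> f x = x * f x^-1.

Definition chentsov_morozova (R : realType) (f : R -> R) (x y : R) : R :=
  1 / (y * f (x / y)).

(* D is the differential at rho of the map sigma |-> phi(sigma) from the
   manifold of density matrices to the matrices. This manifold is open in an
   affine subspace of direction [tangent], hence the Frechet derivative along
   that subspace. The norm is the library's norm on matrices; its values, and
   so e and d, are real elements of [R[i]]. *)
Definition is_differential (R : realType) (phi : R -> R) (n : nat)
    (rho : 'M[R[i]]_n) (D : 'M[R[i]]_n -> 'M[R[i]]_n) : Prop :=
  (forall (a : R) (M N : 'M[R[i]]_n), tangent M -> tangent N ->
     D (a%:C *: M + N) = a%:C *: D M + D N) /\
  (forall e : R[i], 0 < e -> exists2 d : R[i], 0 < d &
     forall sigma : 'M[R[i]]_n, density sigma -> `|sigma - rho| < d ->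
       `|mxfun phi sigma - mxfun phi rho - D (sigma - rho)|
         <= e * `|sigma - rho|).

Definition C1_pos (R : realType) (phi : R -> R) : Prop :=
  forall x : R, 0 < x -> derivable phi x 1 /\ {for x, continuous phi^`()}.

Definition induces_paired_monotone_metric (R : realType) (phi chi : R -> R) :
    Prop :=
  exists f : R -> R,
    [/\ operator_monotone f, symmetric_fun f, f 1 = 1 &
     forall (n : nat) (rho : 'M[R[i]]_n), density rho ->
       exists Dphi Dchi : 'M[R[i]]_n -> 'M[R[i]]_n,
         [/\ is_differential phi rho Dphi, is_differential chi rho Dchi &
          forall A B : 'M[R[i]]_n, tangent A -> tangent B ->
            \tr (Dphi A *m Dchi B) =
            \tr (A *m mxfunLR (chentsov_morozova f) rho B)]].

(* (phi', chi') is equivalent to (phi, chi). Functions count as maps on density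
   matrices, whose eigenvalues lie in (0,1] and exhaust it, so the equalities
   are those on (0,1]: no pair is constrained by its values on (1,+oo). *)
Definition pair_equiv (R : realType) (phi chi phi' chi' : R -> R) : Prop :=
  exists A1 A2 B1 B2 : R, A1 * A2 = 1 /\
    forall x : R, 0 < x <= 1 ->
      phi' x = A1 * phi x + B1 /\ chi' x = A2 * chi x + B2.

(* Main.v *)
Require Import Defs.
From HB Require Import structures.
From mathcomp Require Import all_boot all_order all_algebra.
From mathcomp Require Import complex.
From mathcomp Require Import all_classical all_reals all_analysis.
From mathcomp Require Import ring lra.

Set Implicit Arguments.
Unset Strict Implicit.
Unset Printing Implicit Defensive.

Import Order.TTheory GRing.Theory Num.Theory.
Import numFieldNormedType.Exports.

Local Open Scope ring_scope.

(** In an eigenbasis of rho the differential of phi at rho multiplies the entry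
    (i, j) by the divided difference of phi at the i-th and j-th eigenvalues
    (Daletskii-Krein), so (phi, chi) induces a paired monotone metric iff the
    product phi[x, y] chi[x, y] of divided differences is c_f(x, y).

    As c_f is homogeneous of degree -1 and c_f(x, x) = 1/x, the mixed derivative
    of (phi x - phi y) (chi x - chi y) shows that, for fixed s, the ratio
    u(x) = phi'(s x) / phi'(x) is a continuous solution of u + 1/(s u) = const,
    hence a constant. This turns phi into a solution of x phi' = p phi + const,
    so phi' = C x^(p-1) and chi' = x^(-p) / C. Finally f >= 1 on [1, +oo) forces
    -1 <= p <= 2.

    Conversely, 1/f is up to a factor the second divided difference at (1, 1) of
    t^p + t^(1-p). Since t^(-q), 0 < q < 1, is a limit of nonnegative combinations
    of the functions 1/(t + s), and since divided differences map such
    combinations (and t times them) to such combinations, 1/f is operator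
    antitone. *)

(** * Spectral calculus of Hermitian matrices *)

(** The metric is tested on matrices of trace 1 only, and this shapes the necessity proof: the
    kernel identity is available for [x + y < 1], hence homogeneity only with factors [t < 1]. Any
    two points of (0, 1/2) satisfy the constraint, so the rigidity argument runs there; a separate
    argument carries the result to (0, 1), and continuity carries it to 1.

    Since [phi] and [chi] are merely C1, no second derivative is taken: the mixed derivative is
    formed on a product of increments, one variable at a time, and the differential equation for
    [phi] comes from differentiating in the scaling factor.

    For sufficiency the class of functions is defined by approximation on finite sets, which makes
    it closed under pointwise limits. Constants, powers and the logarithmic kernel all enter it as
    limits, and a divided difference at 1 need only be treated away from 1. *)

Section SpectralCalculus.
Local Open Scope complex_scope.
Local Open Scope sesquilinear_scope.
Variables (R : realType) (n : nat).
Implicit Types (M N rho B : 'M[R[i]]_n) (v w : 'rV[R[i]]_n).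

(** The modulus of [R[i]] is itself an element of [R[i]]; this copy in [R] makes real arithmetic
    available for estimates. *)
Definition cnorm (z : R[i]) : R := complex.Re `|z|.

Lemma cnormE z : (cnorm z)%:C = `|z|.
Proof. by []. Qed.

Definition qform M v : R[i] := (v *m M *m v ^t*) 0 0.

Lemma qformE M v : qform M v = (v *m M *m v^t*) 0 0.
Proof. by []. Qed.

Lemma adjmxM m1 m2 m3 (A : 'M[R[i]]_(m1, m2)) (B : 'M[R[i]]_(m2, m3)) :
  (A *m B)^t* = B^t* *m A^t*.
Proof. by rewrite trmx_mul map_mxM. Qed.

Lemma congr_mulmx2 m1 m2 m3 m4 (A : 'M[R[i]]_(m1, m2)) (X Y : 'M[R[i]]_(m2, m3))
  (B : 'M[R[i]]_(m3, m4)) : X = Y -> A *m X *m B = A *m Y *m B.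
Proof. by move=> ->. Qed.

Lemma adjmxB m1 m2 (A B : 'M[R[i]]_(m1, m2)) : (A - B)^t* = A^t* - B^t*.
Proof. by rewrite [(A - B)^T]raddfB map_mxB. Qed.

Lemma hermsymmxP M : reflect (M^t* = M) (M \is hermsymmx).
Proof.
by apply: (iffP (is_hermitianmxP _ _ _)); rewrite expr0 scale1r => /esym.
Qed.

Lemma hermsymmxB M N :
  M \is hermsymmx -> N \is hermsymmx -> M - N \is hermsymmx.
Proof.
by move=> /hermsymmxP hM /hermsymmxP hN; apply/hermsymmxP; rewrite adjmxB hM hN.
Qed.

Lemma spectralmxKl M : spectralmx M *m (spectralmx M)^t* = 1%:M.
Proof. exact/unitarymxP/spectral_unitarymx. Qed.

Lemma spectralmxKr M : (spectralmx M)^t* *m spectralmx M = 1%:M.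
Proof. exact/mulmx1C/spectralmxKl. Qed.

Lemma hermsymmx_spectralE M : M \is hermsymmx ->
  M = (spectralmx M)^t* *m diag_mx (\row_i (speceig M i)%:C) *m spectralmx M.
Proof.
move=> Mh; have /orthomx_spectralP {1}-> := hermitian_normalmx Mh.
rewrite (invmx_unitary (spectral_unitarymx M)).
apply: congr_mulmx2; congr diag_mx; apply/rowP => i; rewrite mxE RRe_real//.
exact: (mxOverP (hermitian_spectral_diag_real Mh)).
Qed.

Lemma mxfunE (phi : R -> R) M :
  mxfun phi M = (spectralmx M)^t* *m
    diag_mx (\row_i (phi (speceig M i))%:C) *m spectralmx M.
Proof.
rewrite /mxfun diag_mx_sum_delta mulmx_sumr mulmx_suml.
apply: eq_bigr => i _; rewrite /specproj invmx_unitary ?spectral_unitarymx//.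
by rewrite mxE -scalemxAr -scalemxAl.
Qed.

(** In the eigenbasis of [rho], [c(L, R)] is Schur multiplication by the matrix of the values of [c]
    at pairs of eigenvalues. *)
Lemma mxfunLRE (c : R -> R -> R) rho B :
  mxfunLR c rho B = (spectralmx rho)^t* *m
    (\matrix_(i, j) ((c (speceig rho i) (speceig rho j))%:C *
       (spectralmx rho *m B *m (spectralmx rho)^t*) i j)) *m spectralmx rho.
Proof.
rewrite [X in _ *m X *m _]matrix_sum_delta mulmx_sumr mulmx_suml.
apply: eq_bigr => i _; rewrite mulmx_sumr mulmx_suml.
apply: eq_bigr => j _; rewrite /specproj invmx_unitary ?spectral_unitarymx//.
set U := spectralmx rho.
have -> : U^t* *m delta_mx i i *m U *m B *m (U^t* *m delta_mx j j *m U) =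
  U^t* *m (delta_mx i i *m (U *m B *m U^t*) *m delta_mx j j) *m U.
  by rewrite !mulmxA.
rewrite scalemxAl scalemxAr; apply: congr_mulmx2.
apply/matrixP => k l; set X := U *m B *m U^t*.
rewrite [LHS]mxE [RHS]mxE [in LHS]mxE [X in _ = X * _]mxE -mulrA; congr (_ * _).
rewrite (bigD1 j)//= big1 ?addr0; last first.
  by move=> a /negPf ja; rewrite [X in _ * X]mxE ja mulr0.
rewrite mxE (bigD1 i)//= big1 ?addr0; last first.
  by move=> a /negPf ja; rewrite [X in X * _]mxE ja andbF mul0r.
rewrite [delta_mx i i _ _]mxE [delta_mx j j _ _]mxE [delta_mx i j _ _]mxE !eqxx/= andbT.
by case: (k == i); case: (l == j); rewrite ?(mul0r, mulr0, mulr1, mul1r).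
Qed.

Lemma mxfun_hermsymmx phi M : mxfun phi M \is hermsymmx.
Proof.
apply/hermsymmxP; rewrite mxfunE !adjmxM trmxCK mulmxA; apply: congr_mulmx2.
rewrite tr_diag_mx map_diag_mx; congr diag_mx; apply/rowP => i.
by rewrite !mxE; apply: conj_Creal; apply/complex_realP; exists (phi (speceig M i)).
Qed.

(** The weights are the spectral measure of [M] at [v]: comparing quadratic forms becomes comparing
    real sums. *)
Lemma qform_mxfun phi M v : qform (mxfun phi M) v =
  (\sum_i phi (speceig M i) *
     cnorm ((v *m (spectralmx M)^t*) 0 i) ^+ 2)%:C.
Proof.
rewrite /qform mxfunE !mulmxA -mulmxA -{2}[spectralmx M]trmxCK -adjmxM.
set w := v *m _; rewrite mxE rmorph_sum; apply: eq_bigr => i _ /=.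
rewrite mul_mx_diag [X in X * _]mxE [X in _ * X * _]mxE [X in _ * X]mxE [w^T _ _]mxE.
rewrite rmorphM rmorphXn/= cnormE normCK mulrCA mulrA.
by [].
Qed.

Lemma qformD M N v : qform (M + N) v = qform M v + qform N v.
Proof. by rewrite /qform mulmxDr mulmxDl mxE. Qed.

Lemma qformB M N v : qform (M - N) v = qform M v - qform N v.
Proof. by rewrite /qform mulmxBr mulmxBl !mxE. Qed.

Lemma spectral_diagE M : M \is hermsymmx ->
  spectralmx M *m M *m (spectralmx M)^t* =
  diag_mx (\row_i (speceig M i)%:C).
Proof.
move=> Mh; rewrite {2}(hermsymmx_spectralE Mh) !mulmxA spectralmxKl mul1mx.
by rewrite -mulmxA spectralmxKl mulmx1.
Qed.

Lemma qform_row M (A : 'M[R[i]]_n) i : qform M (row i A) = (A *m M *m A^t*) i i.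
Proof.
rewrite /qform -row_mul [LHS]mxE [RHS]mxE; apply: eq_bigr => k _.
by rewrite [row _ _ _ _]mxE; congr (_ * _); rewrite !mxE.
Qed.

Lemma qform_speceig M i : M \is hermsymmx ->
  qform M (row i (spectralmx M)) = (speceig M i)%:C.
Proof. by move=> Mh; rewrite qform_row spectral_diagE// !mxE eqxx. Qed.

Lemma posdefmx_speceig_gt0 M i : posdefmx M -> 0 < speceig M i.
Proof.
move=> [Mh Mp]; rewrite -ltcR -qform_speceig// Mp//.
apply/eqP => r0; have := spectralmxKl M => /(congr1 (row i)).
rewrite row_mul r0 mul0mx row1 => /rowP/(_ i); rewrite !mxE !eqxx => /eqP.
by rewrite eq_sym oner_eq0.
Qed.

Lemma speceig_sum M : M \is hermsymmx -> (\sum_i speceig M i)%:C = \tr M.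
Proof.
move=> Mh; rewrite {2}(hermsymmx_spectralE Mh) mxtrace_mulC mulmxA spectralmxKl.
by rewrite mul1mx mxtrace_diag rmorph_sum; apply: eq_bigr => i _; rewrite mxE.
Qed.

Lemma mxtrace_mxfun phi M : \tr (mxfun phi M) = (\sum_i phi (speceig M i))%:C.
Proof.
rewrite mxfunE mxtrace_mulC mulmxA spectralmxKl mul1mx mxtrace_diag rmorph_sum.
by apply: eq_bigr => i _; rewrite mxE.
Qed.

Lemma mxfun_mul phi psi M :
  mxfun phi M *m mxfun psi M = mxfun (fun x => phi x * psi x) M.
Proof.
rewrite !mxfunE !mulmxA -[_ *m spectralmx M *m _]mulmxA spectralmxKl mulmx1.
rewrite -[_ *m diag_mx _ *m diag_mx _]mulmxA mulmx_diag.
apply: congr_mulmx2; congr diag_mx; apply/rowP => i; rewrite !mxE.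
by rewrite -rmorphM.
Qed.

Lemma eq_mxfun phi psi M :
  (forall i, phi (speceig M i) = psi (speceig M i)) -> mxfun phi M = mxfun psi M.
Proof. by move=> e; apply: eq_bigr => i _; rewrite e. Qed.

Lemma mxfun_cst (c : R) M : mxfun (fun=> c) M = c%:C%:M.
Proof.
rewrite mxfunE; have -> : \row_i c%:C = const_mx c%:C :> 'rV[R[i]]_n.
  by apply/rowP => i; rewrite !mxE.
by rewrite diag_const_mx mul_mx_scalar -scalemxAl spectralmxKr scalemx1.
Qed.

Lemma mxfun1 M : mxfun (fun=> 1) M = 1%:M.
Proof. by rewrite mxfun_cst. Qed.

Lemma mxfunD phi psi M :
  mxfun phi M + mxfun psi M = mxfun (fun x => phi x + psi x) M.
Proof.
by rewrite /mxfun -big_split; apply: eq_bigr => i _ /=; rewrite rmorphD scalerDl.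
Qed.

Lemma mxfun_id M : M \is hermsymmx -> mxfun id M = M.
Proof. by move=> Mh; rewrite mxfunE -hermsymmx_spectralE. Qed.

(* Expand the form of B, which is nonnegative, at v B' - v A'. *)
Lemma inv_antitone (A A' B B' : 'M[R[i]]_n) v :
  A *m A' = 1%:M -> B *m B' = 1%:M -> A' \is hermsymmx -> B' \is hermsymmx ->
  (forall w, 0 <= qform B w) -> (forall w, qform B w <= qform A w) ->
  qform A' v <= qform B' v.
Proof.
move=> AA BB /hermsymmxP hA /hermsymmxP hB pB le.
have A1 := mulmx1C AA; have B1 := mulmx1C BB.
have := pB (v *m B' - v *m A'); have := le (v *m A').
rewrite /qform adjmxB !adjmxM hA hB.
rewrite !mulmxBl !mulmxBr !mulmxA.
do ?rewrite -[v *m _ *m B *m _]mulmxA BB mulmx1.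
have -> : v *m A' *m A = v by rewrite -mulmxA A1 mulmx1.
have -> : v *m B' *m B = v by rewrite -mulmxA B1 mulmx1.
have -> : v *m A' *m B *m B' = v *m A' by rewrite -mulmxA BB mulmx1.
rewrite !mxE => h1 h2; rewrite -subr_ge0.
by apply: le_trans h2 _; rewrite gerDl oppr_le0 subr_ge0.
Qed.

End SpectralCalculus.

Opaque qform mxfun mxfunLR spectralmx spectral_diag.

(** * Operator monotonicity from resolvents *)

Section OperatorMonotone.
Local Open Scope complex_scope.
Local Open Scope sesquilinear_scope.
Variables (R : realType).

(* Approximation on finite sets is enough: comparing h(M) and h(N) only involves
   the values of h at the eigenvalues of M and N. *)
Definition stieltjes_on (S : seq R) (h : R -> R) : Prop :=
  forall e : R, 0 < e -> exists2 l : seq (R * R),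
    all (fun x => (0 <= x.1) && (0 <= x.2)) l &
    {in S, forall t, `|h t - \sum_(x <- l) x.1 / (t + x.2)| <= e}.

(** The hypothesis is the conclusion for resolvents and both sides are linear in [h], so only the
    approximation error has to be absorbed. *)
Lemma stieltjes_sum_le (S : seq R) h (I J : finType) (a x : I -> R) (b y : J -> R) :
  stieltjes_on S h -> (forall i, 0 <= a i) -> (forall j, 0 <= b j) ->
  (forall i, x i \in S) -> (forall j, y j \in S) ->
  (forall s, 0 <= s -> \sum_j (y j + s)^-1 * b j <= \sum_i (x i + s)^-1 * a i) ->
  \sum_j h (y j) * b j <= \sum_i h (x i) * a i.
Proof.
move=> hS a0 b0 xS yS le; apply/ler_addgt0Pr => e e0.
(* The two errors add up to at most [e / K] times the total mass; the 1 keeps [K] positive when all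
   weights vanish. *)
pose K := \sum_i a i + \sum_j b j + 1.
have K0 : 0 < K by rewrite ltr_wpDl// addr_ge0// sumr_ge0.
have [l /allP l0 hl] := hS (e / K) (divr_gt0 e0 K0).
pose g t := \sum_(z <- l) z.1 / (t + z.2).
have le1 : \sum_j g (y j) * b j <= \sum_i g (x i) * a i.
  have E (L : finType) (c z : L -> R) : \sum_j g (z j) * c j =
      \sum_(k <- l) k.1 * \sum_j (z j + k.2)^-1 * c j.
    under eq_bigr do rewrite mulr_suml.
    rewrite exchange_big; apply: eq_bigr => k _; rewrite mulr_sumr.
    by apply: eq_bigr => j _; rewrite mulrA.
  rewrite !E big_seq [leRHS]big_seq; apply: ler_sum => k /l0 /andP[k1 k2].
  by apply: ler_wpM2l => //; exact: le.
have le2 : \sum_j h (y j) * b j <= \sum_j g (y j) * b j + (e / K) * \sum_j b j.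
  rewrite mulr_sumr -big_split; apply: ler_sum => j _ /=.
  rewrite -mulrDl ler_wpM2r// -lerBlDl.
  exact: le_trans (ler_norm _) (hl _ (yS j)).
have le3 : \sum_i g (x i) * a i <= \sum_i h (x i) * a i + (e / K) * \sum_i a i.
  rewrite mulr_sumr -big_split; apply: ler_sum => i _ /=.
  rewrite -mulrDl ler_wpM2r// -lerBlDl.
  by apply: le_trans (ler_norm _) _; rewrite distrC; exact: (hl _ (xS i)).
have : e / K * \sum_j b j + e / K * \sum_i a i <= e.
  rewrite -mulrDr mulrAC ler_pdivrMr// ler_wpM2l ?(ltW e0)// addrC.
  by rewrite /K lerDl.
lra.
Qed.

Variable n : nat.
Implicit Types (M N : 'M[R[i]]_n) (v : 'rV[R[i]]_n).

Lemma qform0 M : qform M 0 = 0.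
Proof. by rewrite qformE !mul0mx mxE. Qed.

Lemma posdefmxW M : posdefmx M -> possemidefmx M.
Proof.
move=> [Mh Mp]; split=> // v; have [->|/Mp/ltW//] := eqVneq v 0.
by rewrite -qformE qform0.
Qed.

Lemma posdefmx_le M N : posdefmx M -> possemidefmx (N - M) -> posdefmx N.
Proof.
move=> [/hermsymmxP Mh Mp] [/hermsymmxP hNM pNM]; split.
  by apply/hermsymmxP; move: hNM; rewrite adjmxB Mh => /addIr.
move=> v v0; have := pNM v; rewrite -!qformE qformB subr_ge0.
by apply: lt_le_trans; rewrite qformE; exact: Mp.
Qed.

Lemma qform_mxfun_le M N v phi psi :
  (qform (mxfun phi M) v <= qform (mxfun psi N) v) =
  (\sum_i phi (speceig M i) * cnorm ((v *m (spectralmx M)^t*) 0 i) ^+ 2 <=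
   \sum_i psi (speceig N i) * cnorm ((v *m (spectralmx N)^t*) 0 i) ^+ 2).
Proof.
have lecE (a b : R[i]) (x y : R) : a = x%:C -> b = y%:C -> (a <= b) = (x <= y).
  by move=> -> ->; rewrite lecR.
exact: lecE (qform_mxfun phi M v) (qform_mxfun psi N v).
Qed.

Lemma qform_resolvent_le M N v (s : R) :
  posdefmx M -> possemidefmx (N - M) -> 0 <= s ->
  qform (mxfun (fun t => (t + s)^-1) N) v <=
  qform (mxfun (fun t => (t + s)^-1) M) v.
Proof.
move=> Mp NM s0; have Np := posdefmx_le Mp NM.
have E (A : 'M[R[i]]_n) : posdefmx A ->
    mxfun (fun t => t + s) A *m mxfun (fun t => (t + s)^-1) A = 1%:M.
  move=> Ap; rewrite mxfun_mul -(mxfun1 A); apply: eq_mxfun => i.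
  by rewrite divff// gt_eqF// ltr_wpDr// posdefmx_speceig_gt0.
have E' (A : 'M[R[i]]_n) : posdefmx A -> mxfun (fun t => t + s) A = A + (s%:C)%:M.
  by move=> Ap; rewrite -mxfunD mxfun_cst mxfun_id//; case: Ap.
have sv w : 0 <= qform ((s%:C)%:M) w.
  rewrite qformE mul_mx_scalar -scalemxAl mxE mulr_ge0 ?ler0c//.
  by rewrite mxE sumr_ge0// => i _; rewrite !mxE mul_conjC_ge0.
apply: (inv_antitone v (E _ Np) (E _ Mp) (mxfun_hermsymmx _ _)
  (mxfun_hermsymmx _ _)) => w.
  rewrite E'// qformD addr_ge0// qformE; exact: (posdefmxW Mp).2.
rewrite !E'// !qformD lerD2r -subr_ge0 -qformB qformE; exact: NM.2.
Qed.

Lemma qform_stieltjes_le M N v h :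
  posdefmx M -> possemidefmx (N - M) ->
  (forall S, {in S, forall t, 0 < t} -> stieltjes_on S h) ->
  qform (mxfun h N) v <= qform (mxfun h M) v.
Proof.
move=> Mp NM hS; have Np := posdefmx_le Mp NM.
pose S := [seq speceig M i | i : 'I_n] ++ [seq speceig N i | i : 'I_n].
have S0 : {in S, forall t, 0 < t}.
  by move=> t; rewrite mem_cat => /orP[] /mapP[i _ ->]; exact: posdefmx_speceig_gt0.
pose a A (i : 'I_n) := cnorm ((v *m (spectralmx A)^t*) 0 i) ^+ 2.
rewrite qform_mxfun_le.
apply: (@stieltjes_sum_le S h _ _ (a M) (speceig M) (a N) (speceig N) (hS S S0)).
- by move=> i; rewrite exprn_even_ge0.
- by move=> i; rewrite exprn_even_ge0.
- by move=> i; rewrite mem_cat map_f ?mem_enum.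
- by move=> i; rewrite mem_cat orbC map_f ?mem_enum.
- by move=> s s0; have := qform_resolvent_le v Mp NM s0; rewrite qform_mxfun_le.
Qed.

End OperatorMonotone.

(** The order is reversed twice: once by [h], as a limit of resolvents, and once by inversion. *)
Lemma operator_monotone_stieltjesV (R : realType) (h f : R -> R) :
  (forall S, {in S, forall t, 0 < t} -> stieltjes_on S h) ->
  (forall t, 0 < t -> 0 < h t) -> (forall t, 0 < t -> f t = (h t)^-1) ->
  operator_monotone f.
Proof.
move=> hS h0 fE n M N Mp NM; have Np := posdefmx_le Mp NM.
have Fh (A : 'M[R[i]]_n) : posdefmx A -> mxfun f A = mxfun (fun t => (h t)^-1) A.
  by move=> Ap; apply: eq_mxfun => i; rewrite fE// posdefmx_speceig_gt0.
have E (A : 'M[R[i]]_n) : posdefmx A ->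
    mxfun h A *m mxfun (fun t => (h t)^-1) A = 1%:M.
  move=> Ap; rewrite mxfun_mul -(mxfun1 A); apply: eq_mxfun => i.
  by rewrite divff// gt_eqF// h0// posdefmx_speceig_gt0.
have pos (g : R -> R) (A : 'M[R[i]]_n) w :
    posdefmx A -> (forall t, 0 < t -> 0 < g t) -> 0 <= qform (mxfun g A) w.
  move=> Ap g0; rewrite qform_mxfun ler0c sumr_ge0// => i _.
  by rewrite mulr_ge0 ?exprn_even_ge0// ltW// g0// posdefmx_speceig_gt0.
rewrite (Fh M Mp) (Fh N Np); split; split=> [|v].
- exact: mxfun_hermsymmx.
- by rewrite -qformE; apply: pos => // t /h0; rewrite invr_gt0.
- exact: hermsymmxB (mxfun_hermsymmx _ _) (mxfun_hermsymmx _ _).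
- rewrite -qformE qformB subr_ge0.
  apply: (inv_antitone v (E _ Mp) (E _ Np) (mxfun_hermsymmx _ _)
    (mxfun_hermsymmx _ _)) => w.
    exact: pos.
  exact: qform_stieltjes_le.
Qed.

(** * Divided differences and limits of resolvents *)

Lemma near_neq (R : realType) (a b : R) : a != b -> \forall z \near b, a != z.
Proof.
move=> ab; near=> z; rewrite -subr_eq0; near: z.
apply: (cvgr_neq0 (a - b)); last by rewrite subr_eq0.
by apply: cvgB; [exact: cvg_cst|exact: cvg_id].
Unshelve. all: by end_near. Qed.

Section DividedDifference.
Variable R : realType.
Implicit Types (phi : R -> R) (x y : R).
Local Open Scope classical_set_scope.

Definition dd phi x y : R :=
  if x == y then phi^`() x else (phi x - phi y) / (x - y).

Lemma ddC phi x y : dd phi x y = dd phi y x.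
Proof.
rewrite /dd eq_sym; case: eqVneq => [->//|yx].
by rewrite -opprB -[x - y]opprB invrN mulrNN.
Qed.

Lemma dd_neq phi x y : x != y -> dd phi x y = (phi x - phi y) / (x - y).
Proof. by rewrite /dd => /negPf->. Qed.

Lemma ddxx phi x : dd phi x x = phi^`() x.
Proof. by rewrite /dd eqxx. Qed.

Lemma ddE phi x y : phi x - phi y = dd phi x y * (x - y).
Proof.
rewrite /dd; case: eqVneq => [->|xy]; first by rewrite !subrr mulr0.
by rewrite divfK// subr_eq0.
Qed.

(** On the diagonal this is the Caratheodory form of derivability; elsewhere it is continuity of a
    quotient. *)
Lemma continuous_dd phi x y :
  {for y, continuous phi} -> (x = y -> derivable phi x 1) ->
  {for y, continuous (dd phi x)}.
Proof.
move=> cphi; have [<- /(_ erefl) dphi|xy _] := eqVneq x y.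
  have /is_derive1_caratheodory[g [gE cg gx]] : is_derive x 1 phi (phi^`() x).
    by rewrite derive1E; exact: derivableP.
  rewrite (_ : dd phi x = g)//; apply/funext => z.
  have [->|xz] := eqVneq z x; first by rewrite ddxx gx.
  by rewrite ddC dd_neq// gE mulfK// subr_eq0.
apply: (@cvg_trans _ ((fun z => (phi x - phi z) / (x - z)) @ y)).
  apply: near_eq_cvg; near=> z; rewrite /= dd_neq//.
  by near: z; exact: near_neq.
have h1 : phi x - phi z @[z --> y] --> phi x - phi y.
  by apply: cvgB => //; exact: cvg_cst.
have h2 : x - z @[z --> y] --> x - y.
  by apply: cvgB; [exact: cvg_cst|exact: cvg_id].
by rewrite dd_neq//; apply: (cvgM h1); apply: cvgV; rewrite ?subr_eq0.
Unshelve. all: by end_near. Qed.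

End DividedDifference.

Section StieltjesClosure.
Variable R : realType.
Implicit Types (S : seq R) (h k : R -> R).
Local Open Scope classical_set_scope.

Lemma eq_stieltjes_on S h k : {in S, h =1 k} -> stieltjes_on S h -> stieltjes_on S k.
Proof. by move=> e hS d /hS[l l0 hl]; exists l => // t tS; rewrite -e// hl. Qed.

Lemma stieltjes_onD S h k : stieltjes_on S h -> stieltjes_on S k ->
  stieltjes_on S (fun t => h t + k t).
Proof.
move=> hS kS e e0; have e20 : 0 < e / 2 by rewrite divr_gt0.
have [l l0 hl] := hS _ e20; have [m m0 km] := kS _ e20.
exists (l ++ m); first by rewrite all_cat l0.
move=> t tS; rewrite big_cat/= opprD addrACA (le_trans (ler_normD _ _))//.
by rewrite [leRHS]splitr lerD ?hl ?km.
Qed.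

Lemma stieltjes_onZ S h (c : R) : 0 <= c -> stieltjes_on S h ->
  stieltjes_on S (fun t => c * h t).
Proof.
move=> c0 hS e e0; have c10 : 0 < c + 1 by rewrite ltr_wpDl.
have [l /allP l0 hl] := hS _ (divr_gt0 e0 c10).
exists [seq (c * x.1, x.2) | x <- l].
  by rewrite all_map; apply/allP => x /l0 /andP[x1 x2] /=; rewrite mulr_ge0.
move=> t tS; rewrite big_map (eq_bigr (fun x => c * (x.1 / (t + x.2)))) => [|x _].
  rewrite -mulr_sumr -mulrBr normrM ger0_norm//.
  apply: le_trans (ler_wpM2l c0 (hl t tS)) _.
  by rewrite mulrCA ler_piMr ?(ltW e0)// ler_pdivrMr// mul1r lerDl.
by rewrite mulrA.
Qed.

Lemma stieltjes_on_inv S (s : R) : 0 <= s -> stieltjes_on S (fun t => (t + s)^-1).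
Proof.
move=> s0 e e0; exists [:: (1, s)]; first by rewrite /= ler01 s0.
by move=> t _; rewrite big_seq1 mul1r subrr normr0 ltW.
Qed.

Lemma stieltjes_on0 S : stieltjes_on S (fun=> 0).
Proof. by move=> e e0; exists [::] => // t _; rewrite big_nil subrr normr0 ltW. Qed.

Lemma stieltjes_on_sum S n (h : nat -> R -> R) :
  (forall i, stieltjes_on S (h i)) -> stieltjes_on S (fun t => \sum_(i < n) h i t).
Proof.
move=> hS; elim: n => [|n IHn].
  by apply: eq_stieltjes_on (stieltjes_on0 S) => t _; rewrite big_ord0.
apply: eq_stieltjes_on (stieltjes_onD IHn (hS n)) => t _.
by rewrite big_ord_recr.
Qed.

(** [S] is finite, so pointwise convergence is uniform on it. *)
Lemma stieltjes_on_lim (T : Type) (F : set_system T) (FF : ProperFilter F) S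
    (h : T -> R -> R) k :
  {in S, forall t, h x t @[x --> F] --> k t} ->
  (\forall x \near F, stieltjes_on S (h x)) -> stieltjes_on S k.
Proof.
move=> hk hS e e0; have e20 : 0 < e / 2 by rewrite divr_gt0.
have [x [xk]] : exists x, {in S, forall t, `|k t - h x t| <= e / 2} /\
  stieltjes_on S (h x).
  apply: (@filter_ex _ F); apply: filterI hS.
  elim: S hk => [|a S IH] hk; first by apply: nearW => x t; rewrite in_nil.
  have {}IH : \forall x \near F, {in S, forall t, `|k t - h x t| <= e / 2}.
    by apply: IH => t tS; apply: hk; rewrite in_cons tS orbT.
  have /cvgrPdist_le/(_ _ e20) ha := hk a (mem_head _ _).
  apply: filterS2 ha IH => x ha hS t; rewrite in_cons => /predU1P[->//|].
  exact: hS.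
move=> /(_ _ e20)[l l0 hl]; exists l => // t tS.
by rewrite [leRHS]splitr (le_trans (ler_distD (h x t) _ _))// lerD ?xk ?hl.
Qed.

(** Termwise, [w / (c t + s) = (w / c) / (t + s / c)]. *)
Lemma stieltjes_on_scale S h (c : R) : 0 < c ->
  stieltjes_on [seq c * t | t <- S] h -> stieltjes_on S (fun t => h (c * t)).
Proof.
move=> c0 hS e /hS[l /allP l0 hl]; exists [seq (x.1 / c, x.2 / c) | x <- l].
  rewrite all_map; apply/allP => x /l0 /andP[x1 x2] /=.
  by rewrite !divr_ge0// ltW.
move=> t tS; rewrite big_map (eq_bigr (fun x => x.1 / (c * t + x.2))).
  by apply: hl; exact: map_f.
move=> x _ /=; rewrite -mulrA -invfM mulrDr; congr (_ / (_ + _)).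
by rewrite mulrCA divff ?mulr1// gt_eqF.
Qed.

(* Rescaling t to c t with c close to 1 moves a finite set away from 1. *)
Lemma stieltjes_on_removable h :
  (forall t, 0 < t -> {for t, continuous h}) ->
  (forall S, {in S, forall t, 0 < t} -> 1 \notin S -> stieltjes_on S h) ->
  forall S, {in S, forall t, 0 < t} -> stieltjes_on S h.
Proof.
move=> ch hS S S0.
apply: (@stieltjes_on_lim _ (1 : R)^' _ S (fun c t => h (c * t))).
  move=> t /S0 t0; have ct : c * t @[c --> (1 : R)^'] --> 1 * t.
    by apply: cvgM; [exact: nbhs_dnbhs|exact: cvg_cst].
  by rewrite mul1r in ct; apply: (cvg_comp _ _ ct); exact: ch.
have Sc : \forall c \near (1 : R)^', {in S, forall t, c * t != 1}.
  elim: S S0 => [|b S IH] S0; first by apply: nearW => c t; rewrite in_nil.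
  have {}IH : \forall c \near (1 : R)^', {in S, forall t, c * t != 1}.
    by apply: IH => t tS; apply: S0; rewrite in_cons tS orbT.
  have b0 : b != 0 by rewrite gt_eqF// S0 ?mem_head.
  have : \forall c \near (1 : R)^', c * b != 1.
    have [->|b1] := eqVneq b 1.
      by near=> c; rewrite mulr1; near: c; exact: nbhs_dnbhs_neq.
    near=> c; have : b^-1 != c.
      by near: c; apply: nbhs_dnbhs; apply: near_neq; rewrite invr_eq1.
    by apply: contraNneq => cb; rewrite -[c](mulfK b0) cb mul1r.
  apply: filterS2 IH => c Sc hb t; rewrite in_cons => /predU1P[->//|]; exact: Sc.
near=> c; have c0 : 0 < c by near: c; apply: nbhs_dnbhs; exact: lt_nbhsr.
apply: stieltjes_on_scale => //; apply: hS.
  by move=> _ /mapP[t /S0 t0 ->]; rewrite mulr_gt0.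
have ct1 : {in S, forall t, c * t != 1} by near: c.
by apply/mapP => -[t tS] /eqP; rewrite eq_sym (negPf (ct1 t tS)).
Unshelve. all: by end_near. Qed.

(** On a resolvent, [(1/(a+s) - 1/(t+s)) / (t-a) = 1 / ((a+s) (t+s))], again a nonnegative multiple
    of a resolvent. *)
Lemma stieltjes_on_dd S h (a : R) : {in S, forall t, 0 < t} -> 0 < a ->
  a \notin S -> stieltjes_on (a :: S) h ->
  stieltjes_on S (fun t => (h a - h t) / (t - a)).
Proof.
move=> S0 a0 aS hS e e0.
have [d d0 dS] : exists2 d, 0 < d & {in S, forall t, d <= `|t - a|}.
  elim: S aS {S0 hS} => [|b S IH]; first by exists 1 => // t; rewrite in_nil.
  rewrite in_cons negb_or => /andP[ab /IH[d d0 dS]].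
  exists (Order.min d `|b - a|).
    by rewrite lt_min d0 normr_gt0 subr_eq0 eq_sym.
  move=> t; rewrite in_cons => /predU1P[->|/dS]; first by rewrite ge_min lexx orbT.
  by move=> dt; rewrite ge_min dt.
(* The errors at [a] and at [t] are both divided by [t - a], of modulus at least [d]. *)
have [l /allP l0 hl] := hS (e * d / 2) ltac:(by rewrite divr_gt0// mulr_gt0).
exists [seq (x.1 / (a + x.2), x.2) | x <- l].
  rewrite all_map; apply/allP => x /l0 /andP[x1 x2] /=.
  by rewrite x2 andbT divr_ge0// addr_ge0// ltW.
move=> t tS; rewrite big_map.
have ta : t - a != 0 by rewrite subr_eq0; apply: contraNneq aS => <-.
have -> : \sum_(x <- l) x.1 / (a + x.2) / (t + x.2) =
    (\sum_(x <- l) x.1 / (a + x.2) - \sum_(x <- l) x.1 / (t + x.2)) / (t - a).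
  rewrite -sumrB mulr_suml big_seq [RHS]big_seq; apply: eq_bigr => x /l0 /andP[x1 x2].
  have h1 : a + x.2 != 0 by rewrite gt_eqF// ltr_wpDr.
  have h2 : t + x.2 != 0 by rewrite gt_eqF// ltr_wpDr// S0.
  by field; rewrite h1 h2 ta.
rewrite -mulrBl normrM normfV ler_pdivrMr ?normr_gt0//.
apply: le_trans (_ : e * d <= _); last by rewrite ler_wpM2l ?dS// ltW.
rewrite [leRHS]splitr opprB addrACA [X in `|X|](_ : _ =
  (h a - \sum_(x <- l) x.1 / (a + x.2)) - (h t - \sum_(x <- l) x.1 / (t + x.2))).
  rewrite (le_trans (ler_normB _ _))// lerD//; apply: hl.
    exact: mem_head.
  by rewrite in_cons tS orbT.
ring.
Qed.

(** On a resolvent, [(t/(t+s) - a/(a+s)) / (t-a) = s / ((a+s) (t+s))]. *)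
Lemma stieltjes_on_mulX_dd S h (a : R) : {in S, forall t, 0 < t} -> 0 < a ->
  a \notin S -> stieltjes_on (a :: S) h ->
  stieltjes_on S (fun t => (t * h t - a * h a) / (t - a)).
Proof.
move=> S0 a0 aS hS e e0.
(* The errors at [t] and [a] are now multiplied by [t] and [a], so the distance to [a] is measured
   relative to [t + a]. *)
have [d d0 dS] : exists2 d, 0 < d & {in S, forall t, d * (t + a) <= `|t - a|}.
  elim: S aS S0 {hS} => [|b S IH]; first by exists 1 => // t; rewrite in_nil.
  rewrite in_cons negb_or => /andP[ab aS] S0.
  have [|d d0 dS] := IH aS; first by move=> t tS; apply: S0; rewrite in_cons tS orbT.
  have b0 : 0 < b by apply: S0; exact: mem_head.
  have ba0 : 0 < b + a by rewrite addr_gt0.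
  exists (Order.min d (`|b - a| / (b + a))).
    by rewrite lt_min d0 divr_gt0// normr_gt0 subr_eq0 eq_sym.
  move=> t; rewrite in_cons => /predU1P[->|tS].
    by rewrite -ler_pdivlMr// ge_min lexx orbT.
  apply: le_trans (dS t tS); rewrite ler_pM2r ?ge_min ?lexx// addr_gt0// S0//.
  by rewrite in_cons tS orbT.
have [l /allP l0 hl] := hS (e * d) ltac:(by rewrite mulr_gt0).
exists [seq (x.1 * x.2 / (a + x.2), x.2) | x <- l].
  rewrite all_map; apply/allP => x /l0 /andP[x1 x2] /=.
  by rewrite x2 andbT divr_ge0 ?mulr_ge0// addr_ge0// ltW.
move=> t tS; rewrite big_map.
have ta : t - a != 0 by rewrite subr_eq0; apply: contraNneq aS => <-.
have -> : \sum_(x <- l) x.1 * x.2 / (a + x.2) / (t + x.2) =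
    (t * (\sum_(x <- l) x.1 / (t + x.2)) - a * \sum_(x <- l) x.1 / (a + x.2)) / (t - a).
  rewrite !mulr_sumr -sumrB mulr_suml big_seq [RHS]big_seq.
  apply: eq_bigr => x /l0 /andP[x1 x2].
  have h1 : a + x.2 != 0 by rewrite gt_eqF// ltr_wpDr.
  have h2 : t + x.2 != 0 by rewrite gt_eqF// ltr_wpDr// S0.
  by field; rewrite h1 h2 ta.
rewrite -mulrBl normrM normfV ler_pdivrMr ?normr_gt0//.
apply: le_trans (_ : e * (d * (t + a)) <= _); last by rewrite ler_wpM2l ?dS// ltW.
rewrite mulrA mulrDr [X in `|X|](_ : _ =
  t * (h t - \sum_(x <- l) x.1 / (t + x.2)) - a * (h a - \sum_(x <- l) x.1 / (a +
    x.2))).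
  rewrite (le_trans (ler_normB _ _))// lerD//.
    rewrite normrM gtr0_norm ?S0// mulrC ler_pM2r ?S0// hl// in_cons tS.
    by rewrite orbT.
  by rewrite normrM gtr0_norm// mulrC ler_pM2r// hl// mem_head.
ring.
Qed.

End StieltjesClosure.

(** * Negative powers as limits of geometric resolvent series *)

Section StieltjesPower.
Variable R : realType.
Local Open Scope classical_set_scope.

Section FixedStep.
Variables (q x : R).
Hypotheses (q01 : 0 < q < 1) (x1 : 1 < x).

Let th : R := x `^ (- q).
Let y : R := x * th.

(* The bilateral series sum_(k in Z) y^k / (t + x^k) is a Riemann sum, on a
   geometric grid, of the integral representation of t^(-q). Its exact behaviour
   under t -> x t replaces the evaluation of the integral. *)
Definition geo_up (t : R) (n : nat) : R := y ^+ n / (t + x ^+ n).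
Definition geo_down (t : R) (n : nat) : R := y^-1 ^+ n.+1 / (t + x^-1 ^+ n.+1).
Definition geo_kernel (t : R) : R :=
  limn (series (geo_up t)) + limn (series (geo_down t)).

Let x0 : 0 < x. Proof. exact: lt_trans x1. Qed.
Let q0 : 0 < q. Proof. by case/andP: q01. Qed.
Let lnx : 0 < ln x. Proof. exact: ln_gt0. Qed.
Let th0 : 0 < th. Proof. exact: powR_gt0. Qed.
Let th1 : th < 1.
Proof.
rewrite /th powRN invf_lt1 ?powR_gt0// /powR gt_eqF// -expR0 ltr_expR.
by rewrite mulr_gt0.
Qed.
Let yE : y = x `^ (1 - q).
Proof. by rewrite /y /th -[X in X * _](powRr1 (ltW x0)) -powRD// (gt_eqF x0)
  implybT. Qed.
Let y1 : 1 < y.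
Proof.
rewrite yE /powR gt_eqF// -{1}expR0 ltr_expR mulr_gt0// subr_gt0.
by case/andP: q01.
Qed.
Let y0 : 0 < y. Proof. exact: lt_trans y1. Qed.
Let yV1 : y^-1 < 1. Proof. by rewrite invf_lt1. Qed.

Lemma geo_up_ge0 t n : 0 < t -> 0 <= geo_up t n.
Proof.
by move=> t0; rewrite divr_ge0 ?exprn_ge0 ?addr_ge0 ?exprn_ge0// ltW.
Qed.

Lemma geo_down_ge0 t n : 0 < t -> 0 <= geo_down t n.
Proof.
by move=> t0; rewrite divr_ge0 ?exprn_ge0 ?addr_ge0 ?exprn_ge0 ?invr_ge0// ltW.
Qed.

(** The upward terms are dominated by [th ^+ n], and [th < 1] because [q > 0]; the downward ones
    below are dominated by powers of [y^-1], and [y > 1] because [q < 1]. *)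
Lemma is_cvg_geo_up t : 0 < t -> cvgn (series (geo_up t)).
Proof.
move=> t0; apply: (@series_le_cvg _ _ (geometric 1 th)).
- by move=> n; exact: geo_up_ge0.
- by move=> n; rewrite /geometric /= mul1r exprn_ge0// ltW.
- move=> n; rewrite /geometric /= mul1r.
  rewrite ler_pdivrMr ?addr_gt0 ?exprn_gt0// /y exprMn [leLHS]mulrC.
  by rewrite ler_pM2l ?exprn_gt0// lerDr ltW.
- by apply: is_cvg_geometric_series; rewrite ger0_norm// ltW.
Qed.

Lemma is_cvg_geo_down t : 0 < t -> cvgn (series (geo_down t)).
Proof.
move=> t0; apply: (@series_le_cvg _ _ (geometric (y^-1 / t) y^-1)).
- by move=> n; exact: geo_down_ge0.
- by move=> n; rewrite /geometric /= mulr_ge0 ?exprn_ge0 ?divr_ge0 ?invr_ge0// ltW.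
- move=> n; rewrite /geometric /= mulrAC -exprS ler_wpM2l ?exprn_ge0 ?invr_ge0
    ?(ltW y0)//.
  by rewrite lef_pV2 ?posrE ?addr_gt0 ?exprn_gt0 ?invr_gt0// lerDl exprn_ge0//
    invr_ge0 ltW.
- by apply: is_cvg_geometric_series; rewrite ger0_norm// ?invr_ge0 ltW.
Qed.

(** Replacing [t] by [x t] shifts the index of the bilateral series by one and brings out the factor
    [y / x = th]. *)
Lemma geo_kernel_scale t : 0 < t -> geo_kernel (x * t) = th * geo_kernel t.
Proof.
move=> t0; have xt0 : 0 < x * t by rewrite mulr_gt0.
(* [geo_down] at [n] is the term of index [k = -(n+1)]: the left side runs over [k] from [-n] to
   [n], the right side from [-(n+1)] to [n-1]. *)
have E n : series (geo_up (x * t)) n.+1 + series (geo_down (x * t)) n =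
    th * (series (geo_up t) n + series (geo_down t) n.+1).
  rewrite /series /= big_nat_recl// addrAC -addrA.
  rewrite [in RHS]big_nat_recl// addrCA addrA mulrDr addrC !mulrDr !mulr_sumr.
  have up i : geo_up (x * t) i.+1 = th * geo_up t i.
    have h : t + x ^+ i != 0 by rewrite gt_eqF// addr_gt0// exprn_gt0.
    rewrite /geo_up exprS [x ^+ i.+1]exprS -mulrDr invfM /y.
    by field; rewrite h gt_eqF.
  have down i : geo_down (x * t) i = th * geo_down t i.+1.
    have h : t + x^-1 ^+ i.+2 != 0.
      by rewrite gt_eqF// addr_gt0// exprn_gt0// invr_gt0.
    have -> : geo_down (x * t) i = y^-1 ^+ i.+1 / (x * (t + x^-1 ^+ i.+2)).
      by rewrite /geo_down mulrDr [in x * _ ^+ _]exprS mulrA divff ?mul1r// gt_eqF.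
    rewrite /geo_down [y^-1 ^+ i.+2]exprS.
    move: h; set Z := t + _; set Y := y^-1 ^+ _ => h.
    by rewrite /y; field; rewrite h !gt_eqF.
  rewrite (eq_bigr _ (fun i _ => up i)) (eq_bigr _ (fun i _ => down i)).
  have -> : geo_up (x * t) 0 = th * geo_down t 0.
    rewrite /geo_up /geo_down !expr0 !expr1 /y.
    have h : t * x + 1 != 0 by rewrite gt_eqF// addr_gt0// mulr_gt0.
    by field; rewrite h !gt_eqF.
  ring.
have cl : series (geo_up (x * t)) n.+1 + series (geo_down (x * t)) n @[n --> \oo]
    --> geo_kernel (x * t).
  apply: cvgD; last exact: is_cvg_geo_down.
  by rewrite (cvg_shiftS (series _)); exact: is_cvg_geo_up.
have cr : th * (series (geo_up t) n + series (geo_down t) n.+1) @[n --> \oo]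
    --> th * geo_kernel t.
  apply: cvgM; first exact: cvg_cst.
  apply: cvgD; first exact: is_cvg_geo_up.
  by rewrite (cvg_shiftS (series _)); exact: is_cvg_geo_down.
have cr' : th * (series (geo_up t) n + series (geo_down t) n.+1) @[n --> \oo]
    --> geo_kernel (x * t).
  by apply: cvg_trans cl; apply: near_eq_cvg; apply: nearW => n; rewrite E.
exact: norm_cvg_unique cr' cr.
Qed.

Lemma geo_kernel_nincr t u : 0 < t -> t <= u -> geo_kernel u <= geo_kernel t.
Proof.
move=> t0 tu; have u0 := lt_le_trans t0 tu.
apply: lerD.
  apply: ler_lim; [exact: is_cvg_geo_up|exact: is_cvg_geo_up|].
  apply: nearW => n; apply: ler_sum => i _; apply: ler_wpM2l.
    by rewrite exprn_ge0// ltW.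
  by rewrite lef_pV2 ?posrE ?addr_gt0 ?exprn_gt0// lerD2r.
apply: ler_lim; [exact: is_cvg_geo_down|exact: is_cvg_geo_down|].
apply: nearW => n; apply: ler_sum => i _; apply: ler_wpM2l.
  by rewrite exprn_ge0// invr_ge0 ltW.
by rewrite lef_pV2 ?posrE ?addr_gt0 ?exprn_gt0 ?invr_gt0// lerD2r.
Qed.

Lemma geo_kernel1_gt0 : 0 < geo_kernel 1.
Proof.
have h : series (geo_up 1) 1%N <= limn (series (geo_up 1)).
  apply: nondecreasing_cvgn_le; last exact: is_cvg_geo_up.
  by apply/nondecreasing_seqP => n; rewrite /series /= big_nat_recr//= lerDl geo_up_ge0.
have h' : 0 <= limn (series (geo_down 1)).
  apply: limr_ge; first exact: is_cvg_geo_down.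
  by apply: nearW => n; apply: sumr_ge0 => i _; exact: geo_down_ge0.
rewrite ltr_pwDl//; apply: lt_le_trans h.
by rewrite /series /= big_nat1 /geo_up !expr0 divr_gt0// addr_gt0.
Qed.

(** The product [g] of the kernel and [t ^ q] is invariant under [t -> x t], so its values are those
    on [[1, x]]. There monotonicity pins it between [th] and [x ^ q] times its value at 1. *)
Lemma geo_kernel_powR t : 0 < t ->
  `|t `^ (- q) - geo_kernel t / geo_kernel 1| <= t `^ (- q) * (x `^ q - 1).
Proof.
pose g t := geo_kernel t * t `^ q.
have gx u : 0 < u -> g (x * u) = g u.
  move=> u0; rewrite /g geo_kernel_scale// powRM ?ltW// /th powRN.
  by rewrite mulrACA mulVf ?mul1r// gt_eqF// powR_gt0.
have gxn n u : 0 < u -> g (x ^+ n * u) = g u.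
  move=> u0; elim: n => [|n IHn]; first by rewrite mul1r.
  by rewrite exprS -mulrA gx// mulr_gt0// exprn_gt0.
have gle n u : 1 <= u -> u <= x ^+ n -> exists2 v, 1 <= v <= x & g u = g v.
  elim: n u => [|n IHn] u u1 ux.
    by exists u; rewrite // u1 (le_trans ux)// expr0 ltW.
  have [ux1|xu] := leP u x; first by exists u; rewrite // u1.
  have u0 : 0 < u by exact: lt_le_trans u1.
  have [||v vx gv] := IHn (u / x); first by rewrite ler_pdivlMr// mul1r ltW.
    by rewrite ler_pdivrMr// mulrC -exprS.
  exists v => //; rewrite -gv -(gx (u / x)) ?divr_gt0//.
  by rewrite mulrCA divff ?mulr1// gt_eqF.
have big (K : R) : 0 < K -> exists n, K <= x ^+ n.
  move=> K0; have xV1 : `|x^-1| < 1 by rewrite ger0_norm ?invr_ge0 ?(ltW x0)// invf_lt1.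
  have /cvgrPdist_le/(_ K^-1) := cvg_geometric 1 xV1.
  rewrite invr_gt0 => /(_ K0)[n _ /(_ n (leqnn n))] /=; rewrite /geometric /=
    mul1r sub0r normrN.
  rewrite ger0_norm ?exprn_ge0 ?invr_ge0 ?(ltW x0)// exprVn.
  by rewrite lef_pV2 ?posrE ?exprn_gt0//; exists n.
have gall u : 0 < u -> exists2 v, 1 <= v <= x & g u = g v.
  move=> u0; have [n nu] := big u^-1 ltac:(by rewrite invr_gt0).
  have xu0 : 0 < x ^+ n * u by rewrite mulr_gt0// exprn_gt0.
  have [m mu] := big _ xu0.
  have [|v vx gv] := gle m (x ^+ n * u) _ mu.
    by rewrite -ler_pdivrMr// div1r.
  by exists v => //; rewrite -gv gxn.
move=> t0; have [v /andP[v1 vx] gv] := gall t t0.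
have v0 : 0 < v := lt_le_trans ltr01 v1.
have T1 := geo_kernel1_gt0.
have tq : 0 < t `^ q by exact: powR_gt0.
have xq : 1 <= x `^ q by rewrite -(powRr0 x) ler_powR// ltW.
have vq : 1 <= v `^ q by rewrite -(powRr0 v) ler_powR// ltW.
have vxq : v `^ q <= x `^ q by rewrite ge0_ler_powR ?nnegrE// ltW.
have thE : th = (x `^ q)^-1 by rewrite /th powRN.
have Tv1 : geo_kernel v <= geo_kernel 1 by exact: geo_kernel_nincr.
have Tvx : th * geo_kernel 1 <= geo_kernel v.
  by rewrite -geo_kernel_scale// mulr1; exact: geo_kernel_nincr.
have Tv0 : 0 < geo_kernel v by apply: lt_le_trans Tvx; rewrite mulr_gt0.
have gu : g v <= x `^ q * geo_kernel 1.
  by rewrite /g mulrC ler_pM ?powR_ge0 ?(ltW Tv0).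
have gl : th * geo_kernel 1 <= g v by rewrite (le_trans Tvx)// /g ler_pMr.
have -> : geo_kernel t = g v * t `^ (- q) by rewrite -gv /g powRN mulfK// gt_eqF.
have -> : t `^ (- q) - g v * t `^ (- q) / geo_kernel 1 =
    t `^ (- q) * (1 - g v / geo_kernel 1).
  by rewrite mulrBr mulr1 mulrA; congr (_ - _ / _); rewrite mulrC.
rewrite normrM ger0_norm ?powR_ge0// ler_wpM2l ?powR_ge0//.
have h1 : g v / geo_kernel 1 <= x `^ q by rewrite ler_pdivrMr.
have h2 : th <= g v / geo_kernel 1 by rewrite ler_pdivlMr.
rewrite ler_norml; apply/andP; split; first by lra.
(* As [th] is the inverse of [x ^ q], the lower deviation [1 - th] is at most the upper one. *)
have : 2 <= x `^ q + th.
  rewrite thE -subr_ge0 -(pmulr_lge0 _ (lt_le_trans ltr01 xq)).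
  rewrite (_ : _ * _ = (x `^ q - 1) ^+ 2) ?sqr_ge0//.
  by field; rewrite gt_eqF// powR_gt0.
lra.
Qed.

Lemma stieltjes_on_geo_kernel (S : seq R) : {in S, forall t, 0 < t} ->
  stieltjes_on S (fun t => geo_kernel t / geo_kernel 1).
Proof.
move=> S0; have T1 := geo_kernel1_gt0.
apply: (@stieltjes_on_lim _ _ \oo _ S (fun n t => (geo_kernel 1)^-1 *
    (\sum_(i < n) y ^+ i * (t + x ^+ i)^-1 +
     \sum_(i < n) y^-1 ^+ i.+1 * (t + x^-1 ^+ i.+1)^-1))).
  move=> t /S0 t0; rewrite mulrC; apply: cvgM; first exact: cvg_cst.
  apply: cvgD.
    apply: cvg_trans (is_cvg_geo_up t0); apply: near_eq_cvg; apply: nearW => n.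
    by rewrite /series /= big_mkord.
  apply: cvg_trans (is_cvg_geo_down t0); apply: near_eq_cvg; apply: nearW => n.
  by rewrite /series /= big_mkord.
apply: nearW => n; apply: stieltjes_onZ; first by rewrite invr_ge0 ltW.
apply: stieltjes_onD.
  apply: (@stieltjes_on_sum _ S n (fun i t => y ^+ i * (t + x ^+ i)^-1)) => i.
  apply: stieltjes_onZ; first by rewrite exprn_ge0// ltW.
  by apply: stieltjes_on_inv; rewrite exprn_ge0// ltW.
apply: (@stieltjes_on_sum _ S n (fun i t => y^-1 ^+ i.+1 * (t + x^-1 ^+ i.+1)^-1)) => i.
apply: stieltjes_onZ; first by rewrite exprn_ge0// invr_ge0 ltW.
by apply: stieltjes_on_inv; rewrite exprn_ge0// invr_ge0 ltW.
Qed.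

End FixedStep.

(** The grid is refined: the relative error [x ^ q - 1] vanishes as [x] decreases to 1. *)
Lemma stieltjes_on_powR (q : R) (S : seq R) : 0 < q < 1 ->
  {in S, forall t, 0 < t} -> stieltjes_on S (fun t => t `^ (- q)).
Proof.
move=> q01 S0.
apply: (@stieltjes_on_lim _ _ (1 : R)^'+ _ S
    (fun x t => geo_kernel q x t / geo_kernel q x 1)).
  move=> t /S0 t0; apply/cvgrPdist_le => e e0.
  have c : t `^ (- q) * (x `^ q - 1) @[x --> (1 : R)^'+] --> t `^ (- q) * (1 `^ q - 1).
    apply: cvgM; first exact: cvg_cst.
    apply: cvgB; last exact: cvg_cst.
    apply: cvg_at_right_filter.
    have := is_derive1_powR q (@ltr01 R) =>
      -[/derivable1_diffP/differentiable_continuous c _].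
    exact: c.
  rewrite powR1 subrr mulr0 in c.
  have /cvgrPdist_le/(_ _ e0) := c; apply: filterS2 (nbhs_right_gt 1) => x x1 h.
  apply: le_trans (geo_kernel_powR q01 x1 t0) _.
  by apply: le_trans h; rewrite sub0r normrN ler_norm.
near=> x; apply: stieltjes_on_geo_kernel => //.
Unshelve. all: by end_near. Qed.

End StieltjesPower.

(** * The kernels of the two families of pairs *)

Section ModelKernels.
Variable R : realType.
Implicit Types (p q t c x y : R) (S : seq R).
Local Open Scope classical_set_scope.

Definition paired_kernel (phi chi : R -> R) x y : R := dd phi x y * dd chi x y.

Definition power_fun p x : R := x `^ p / p.

Definition stieltjes (h : R -> R) :=
  forall S, {in S, forall t, 0 < t} -> stieltjes_on S h.

Lemma is_derive_power_fun p x : p != 0 -> 0 < x ->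
  is_derive x 1 (power_fun p) (x `^ (p - 1)).
Proof.
move=> p0 x0; have d := is_derive1_powR p x0.
rewrite (_ : power_fun p = p^-1 \*: (@powR R ^~ p)).
  apply: (is_derive_eq (is_deriveZ _ _ )).
  by rewrite scalerA mulVf// scale1r.
by apply/funext => z; rewrite /power_fun mulrC.
Qed.

Lemma continuous_is_derive (f : R -> R) x d : is_derive x 1 f d ->
  {for x, continuous f}.
Proof. by move=> [/derivable1_diffP/differentiable_continuous]. Qed.

Lemma dd_is_derive (f : R -> R) x d : is_derive x 1 f d -> dd f x x = d.
Proof. by move=> [_ <-]; rewrite ddxx derive1E. Qed.

Lemma derivable_powR_gt0 p x : 0 < x -> derivable (@powR R ^~ p) x 1.
Proof. by move=> x0; have [] := is_derive1_powR p x0. Qed.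

Lemma derivable_power_fun p x : p != 0 -> 0 < x -> derivable (power_fun p) x 1.
Proof. by move=> p0 x0; have [] := is_derive_power_fun p0 x0. Qed.

Lemma derivable_ln_gt0 x : 0 < x -> derivable (@ln R) x 1.
Proof. by move=> x0; have [] := is_derive1_ln x0. Qed.

Lemma continuous_dd_derivable (f : R -> R) x t :
  (forall y, 0 < y -> derivable f y 1) -> 0 < x -> 0 < t ->
  {for t, continuous (dd f x)}.
Proof.
move=> fE x0 t0; apply: continuous_dd => [|_]; last exact: fE.
exact/differentiable_continuous/derivable1_diffP/fE.
Qed.

(* On combinations of 1/(t + s), h is nonincreasing and t h is nondecreasing. *)
Lemma stieltjes_gt0 h t : stieltjes h -> h 1 = 1 -> 0 < t -> 0 < h t.
Proof.
move=> hS h1 t0; pose m := Order.min 1 t^-1.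
have m0 : 0 < m by rewrite lt_min ltr01 invr_gt0.
have m1 : m <= 1 by rewrite ge_min lexx.
have mt : m * t <= 1 by rewrite -ler_pdivlMr// div1r ge_min lexx orbT.
have [|l /allP l0 hl] := hS [:: 1; t] _ (m / 4) ltac:(by rewrite divr_gt0).
  by move=> s; rewrite !inE => /orP[]/eqP->.
have := hl 1; have := hl t; rewrite !inE !eqxx orbT h1 => /(_ isT) + /(_ isT).
have : m * \sum_(x <- l) x.1 / (1 + x.2) <= \sum_(x <- l) x.1 / (t + x.2).
  rewrite mulr_sumr big_seq [leRHS]big_seq; apply: ler_sum => x /l0 /andP[x1 x2].
  have h2 : 0 < 1 + x.2 by rewrite ltr_wpDr.
  have h3 : 0 < t + x.2 by rewrite ltr_wpDr.
  rewrite mulrCA ler_wpM2l// ler_pdivrMr// mulrC ler_pdivlMr// mulrDr.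
  rewrite lerD// ler_piMl//.
set A := \sum_(x <- l) _; set B := \sum_(x <- l) _.
rewrite !ler_norml => mAB /andP[tB _] /andP[_ tA].
have : m * (1 - m / 4) <= m * A by rewrite ler_wpM2l ?(ltW m0)//; lra.
have : m * m <= m by rewrite ler_piMr// ltW.
move: tB; lra.
Qed.

Lemma stieltjes_powR q : 0 < q < 1 -> stieltjes (fun t => t `^ (- q)).
Proof. by move=> q01 S S0; exact: stieltjes_on_powR. Qed.

(** Constants belong to the class only in the limit, through [n / (t + n)]. *)
Lemma stieltjes1 : stieltjes (fun=> 1).
Proof.
move=> S S0; apply: (@stieltjes_on_lim _ _ \oo _ S (fun n t => n%:R * (t + n%:R)^-1)).
  move=> t /S0 t0; apply/cvgrPdist_le => e e0.
  near=> n.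
  have tn : 0 < t + n%:R by rewrite ltr_wpDr.
  have -> : 1 - n%:R * (t + n%:R)^-1 = t / (t + n%:R) by field; rewrite gt_eqF.
  rewrite ger0_norm ?divr_ge0 ?(ltW tn) ?(ltW t0)// ler_pdivrMr// -ler_pdivrMl//.
  rewrite ler_wpDl ?(ltW t0)// mulrC.
  by near: n; exact: nbhs_infty_ger.
apply: nearW => n; apply: stieltjes_onZ => //; exact: stieltjes_on_inv.
Unshelve. all: by end_near. Qed.

(** Write [t ^ p] as [t] times the negative power [t ^ (-(1 - p))]. *)
Lemma stieltjes_dd_powR p : 0 < p < 1 -> stieltjes (dd (@powR R ^~ p) 1).
Proof.
move=> /andP[p0 p1]; apply: stieltjes_on_removable => [t t0|S S0 S1].
  exact: (continuous_dd_derivable (@derivable_powR_gt0 p) ltr01 t0).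
have pS : stieltjes_on (1 :: S) (fun t => t `^ (- (1 - p))).
  apply: stieltjes_powR => [|t]; first by lra.
  by rewrite in_cons => /predU1P[->//|/S0].
apply: eq_stieltjes_on (stieltjes_on_mulX_dd S0 ltr01 S1 pS) => t tS.
have t1 : t != 1 by apply: contraNneq S1 => <-.
rewrite ddC dd_neq// opprB (mulr_powRB1 (ltW (S0 t tS)) p0).
by rewrite powR1 mul1r.
Qed.

Lemma stieltjes_dd_powRN q : 0 < q < 1 ->
  stieltjes (fun t => - dd (@powR R ^~ (- q)) 1 t).
Proof.
move=> q01; apply: stieltjes_on_removable => [t t0|S S0 S1].
  apply: cvgN; exact: (continuous_dd_derivable (@derivable_powR_gt0 (- q)) ltr01 t0).
have pS : stieltjes_on (1 :: S) (fun t => t `^ (- q)).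
  apply: stieltjes_powR => // t.
  by rewrite in_cons => /predU1P[->//|/S0].
apply: eq_stieltjes_on (stieltjes_on_dd S0 ltr01 S1 pS) => t tS.
have t1 : t != 1 by apply: contraNneq S1 => <-.
by rewrite ddC dd_neq// -mulNr opprB.
Qed.

Lemma paired_kernelC phi chi x y :
  paired_kernel phi chi x y = paired_kernel phi chi y x.
Proof. by rewrite /paired_kernel ddC [dd chi x y]ddC. Qed.

Lemma powR_ne0 t p : 0 < t -> t `^ p != 0.
Proof. by move=> t0; rewrite gt_eqF// powR_gt0. Qed.

Lemma continuous_power_kernel p t : p != 0 -> p != 1 -> 0 < t ->
  {for t, continuous (paired_kernel (power_fun p) (power_fun (1 - p)) 1)}.
Proof.
move=> p0 p1 t0.
have p10 : 1 - p != 0 by rewrite subr_eq0 eq_sym.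
apply: cvgM.
  exact: (continuous_dd_derivable (fun x => @derivable_power_fun _ x p0) ltr01 t0).
exact: (continuous_dd_derivable (fun x => @derivable_power_fun _ x p10) ltr01 t0).
Qed.

(** Expanded, the numerator is [1 + t - t ^ p - t ^ (1-p)]. Its affine part has no second divided
    difference, which turns the product of divided differences into a sum. Writing [t / t ^ p]
    leaves [field] a single power. *)
Lemma power_kernelE p t : 0 < t -> t != 1 ->
  paired_kernel (power_fun p) (power_fun (1 - p)) 1 t =
  (1 - t `^ p) * (1 - t / t `^ p) / (p * (1 - p) * (t - 1) ^+ 2).
Proof.
move=> t0 t1; rewrite /paired_kernel !dd_neq 1?eq_sym// /power_fun !powR1.
rewrite powRB ?(gt_eqF t0) ?implybT// (powRr1 (ltW t0)) -!mulrBl.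
rewrite -[1 - t]opprB; set a := 1 - _; set b := 1 - _ / _.
by rewrite expr2 !invfM !invrN; ring.
Qed.

(* Second divided differences at 1 of t^p = t * t^(-(1-p)) and of t^(1-p). *)
Lemma stieltjes_power_kernel01 p : 0 < p < 1 ->
  stieltjes (paired_kernel (power_fun p) (power_fun (1 - p)) 1).
Proof.
move=> p01; have /andP[p0 p1] := p01.
apply: stieltjes_on_removable => [t t0|S S0 S1].
  by apply: continuous_power_kernel => //; [rewrite gt_eqF|rewrite lt_eqF].
have S10 : {in 1 :: S, forall t, 0 < t}.
  by move=> t; rewrite in_cons => /predU1P[->//|/S0].
have h1 := stieltjes_on_dd S0 ltr01 S1 (stieltjes_dd_powR p01 S10).
have p01' : 0 < 1 - p < 1 by lra.
have h2 := stieltjes_on_dd S0 ltr01 S1 (stieltjes_dd_powR p01' S10).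
have c0 : 0 <= (p * (1 - p))^-1 by rewrite invr_ge0 mulr_ge0//; lra.
apply: eq_stieltjes_on (stieltjes_onZ c0 (stieltjes_onD h1 h2)) => t tS.
have t0 := S0 t tS; have t1 : t != 1 by apply: contraNneq S1 => <-.
rewrite power_kernelE// !(dd_is_derive (is_derive1_powR _ ltr01)) !powR1.
rewrite !dd_neq 1?eq_sym// !powR1 powRB ?(gt_eqF t0) ?implybT//.
rewrite (powRr1 (ltW t0)).
have X0 := powR_ne0 p t0; move: X0; set X := t `^ p => X0.
have t1' : t - 1 != 0 by rewrite subr_eq0.
have t1'' : 1 - t != 0 by rewrite subr_eq0 eq_sym.
have p1' : 1 - p != 0 by rewrite gt_eqF// subr_gt0.
by field; rewrite X0 t1' t1'' p1' gt_eqF.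
Qed.

(* As before, with t^(1-p) = t^(-q) and t^p = t * (t * t^(-(1-q))) for q = p - 1. *)
Lemma stieltjes_power_kernel12 p : 1 < p < 2 ->
  stieltjes (paired_kernel (power_fun p) (power_fun (1 - p)) 1).
Proof.
move=> p12; have /andP[p1 p2] := p12.
apply: stieltjes_on_removable => [t t0|S S0 S1].
  by apply: continuous_power_kernel => //; rewrite gt_eqF//; lra.
have S10 : {in 1 :: S, forall t, 0 < t}.
  by move=> t; rewrite in_cons => /predU1P[->//|/S0].
have q01 : 0 < p - 1 < 1 by lra.
have h1 := stieltjes_on_dd S0 ltr01 S1 (stieltjes_dd_powRN q01 S10).
have h2 := stieltjes_on_mulX_dd S0 ltr01 S1 (stieltjes_dd_powR q01 S10).
have c0 : 0 <= (p * (p - 1))^-1 by rewrite invr_ge0 mulr_ge0//; lra.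
apply: eq_stieltjes_on (stieltjes_onZ c0 (stieltjes_onD h1 h2)) => t tS.
have t0 := S0 t tS; have t1 : t != 1 by apply: contraNneq S1 => <-.
rewrite power_kernelE// !(dd_is_derive (is_derive1_powR _ ltr01)) !powR1.
rewrite !dd_neq 1?eq_sym// !powR1 powRN powRB ?(gt_eqF t0) ?implybT//.
rewrite (powRr1 (ltW t0)).
have X0 := powR_ne0 p t0; move: X0; set X := t `^ p => X0.
have t1' : t - 1 != 0 by rewrite subr_eq0.
have t1'' : 1 - t != 0 by rewrite subr_eq0 eq_sym.
have p1' : 1 - p != 0 by rewrite lt_eqF// subr_lt0.
have p1'' : p - 1 != 0 by rewrite gt_eqF// subr_gt0.
have p0' : p != 0 by rewrite gt_eqF//; lra.
by field; rewrite X0 t1' t1'' p1' p1'' p0' gt_eqF.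
Qed.

(** At this endpoint the kernel is [(1 + 1/t) / 2]. *)
Lemma stieltjes_power_kernel2 :
  stieltjes (paired_kernel (power_fun 2) (power_fun (1 - 2)) 1).
Proof.
apply: stieltjes_on_removable => [t t0|S S0 S1].
  by apply: continuous_power_kernel => //; rewrite gt_eqF//; lra.
have c0 : 0 <= (2 : R)^-1 by rewrite invr_ge0.
have := stieltjes_onZ c0 (stieltjes_onD (stieltjes1 S0) (stieltjes_on_inv S (lexx 0))).
apply: eq_stieltjes_on => t tS.
have t0 := S0 t tS; have t1 : t != 1 by apply: contraNneq S1 => <-.
rewrite power_kernelE// powR_mulrn ?(ltW t0)// addr0.
have t1' : t - 1 != 0 by rewrite subr_eq0.
by field; rewrite t1' gt_eqF.
Qed.

Lemma stieltjes_power_kernel p : -1 <= p <= 2 -> p != 0 -> p != 1 ->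
  stieltjes (paired_kernel (power_fun p) (power_fun (1 - p)) 1).
Proof.
(* The kernel is invariant under [p -> 1 - p], which preserves the interval [[-1, 2]]. *)
move=> p12 p0 p1; wlog p05 : p p12 p0 p1 / 2^-1 <= p.
  move=> wl; have [|p05] := leP 2^-1 p; first exact: wl.
  have := wl (1 - p); rewrite (_ : 1 - (1 - p) = p); last by ring.
  rewrite /paired_kernel; under eq_fun do rewrite mulrC.
  by apply; rewrite ?subr_eq0 1?eq_sym//; lra.
have [pl1|pg1|/eqP] := ltgtP p 1; last by rewrite (negPf p1).
  by apply: stieltjes_power_kernel01; lra.
have [pl2|pg2|->] := ltgtP p 2.
- by apply: stieltjes_power_kernel12; lra.
- by lra.
- exact: stieltjes_power_kernel2.
Qed.

Lemma dd_id x y : dd (@id R) x y = 1.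
Proof.
rewrite /dd; case: eqVneq => [_|xy]; last by rewrite divff// subr_eq0.
by rewrite derive1E derive_id.
Qed.

(** The logarithm is the limit of [(t ^ p - 1) / p] as [p] decreases to 0, that is, the derivative
    of [t ^ p] in the exponent at 0. *)
Lemma stieltjes_log_kernel : stieltjes (paired_kernel (@id R) (@ln R) 1).
Proof.
rewrite (_ : paired_kernel _ _ _ = dd (@ln R) 1); last first.
  by apply/funext => t; rewrite /paired_kernel dd_id mul1r.
apply: stieltjes_on_removable => [t t0|S S0 S1].
  exact: (continuous_dd_derivable derivable_ln_gt0 ltr01 t0).
apply: (@stieltjes_on_lim _ _ (0 : R)^'+ _ S (fun p t => p^-1 * dd (@powR R ^~ p) 1 t)).
  move=> t tS; have t0 := S0 t tS; have t1 : t != 1 by apply: contraNneq S1 => <-.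
  rewrite dd_neq 1?eq_sym// ln1 sub0r.
  have d : is_derive (0 : R) 1 (fun p => expR (ln t * p)) (ln t).
    have d1 : is_derive (0 : R) 1 (ln t \*: @id R) (ln t).
      by apply: is_derive_eq; rewrite /GRing.scale /= mulr1.
    have := @is_derive1_comp _ expR (ln t \*: @id R) 0 _ _ (is_derive_expR _) d1.
    by rewrite /= scaler0 expR0 mul1r.
  pose f p := expR (ln t * p).
  have c : {for (0 : R), continuous (dd f 0)}.
    apply: continuous_dd => [|_]; first exact: continuous_is_derive d.
    by have [] := d.
  have c' : dd f 0 p * - (1 - t)^-1 @[p --> (0 : R)^'+] -->
      dd f 0 0 * - (1 - t)^-1.
    by apply: cvgM; [exact: cvg_at_right_filter|exact: cvg_cst].
  rewrite (dd_is_derive d) in c'; rewrite mulNr -mulrN.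
  apply: cvg_trans c'; apply: near_eq_cvg; near=> p.
  have p0 : 0 < p by [].
  rewrite [dd f 0 p]ddC dd_neq ?gt_eqF// /f [dd (@powR R ^~ p) _ _]dd_neq
    1?eq_sym// powR1 mulr0 expR0 subr0.
  by rewrite /powR gt_eqF// [p * _]mulrC; ring.
near=> p; apply: stieltjes_onZ; first by rewrite invr_ge0.
by apply: stieltjes_dd_powR => //; apply/andP; split.
Unshelve. all: by end_near. Qed.

Lemma power_kernel11 p : p != 0 -> p != 1 ->
  paired_kernel (power_fun p) (power_fun (1 - p)) 1 1 = 1.
Proof.
move=> p0 p1; have p10 : 1 - p != 0 by rewrite subr_eq0 eq_sym.
rewrite /paired_kernel (dd_is_derive (is_derive_power_fun p0 ltr01)).
by rewrite (dd_is_derive (is_derive_power_fun p10 ltr01)) !powR1 mulr1.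
Qed.

Lemma log_kernel11 : paired_kernel (@id R) (@ln R) 1 1 = 1.
Proof.
by rewrite /paired_kernel dd_id (dd_is_derive (is_derive1_ln ltr01)) invr1 mulr1.
Qed.

Lemma dd_power_fun_scale p c x y : p != 0 -> 0 < c -> 0 < x -> 0 < y ->
  dd (power_fun p) (c * x) (c * y) = c `^ (p - 1) * dd (power_fun p) x y.
Proof.
move=> p0 c0 x0 y0; have [<-|xy] := eqVneq x y.
  have cx0 : 0 < c * x by rewrite mulr_gt0.
  rewrite !(dd_is_derive (is_derive_power_fun p0 _))//.
  by rewrite powRM// ltW.
have cxy : c * x != c * y by rewrite (inj_eq (mulfI (lt0r_neq0 c0))).
rewrite !dd_neq// /power_fun !powRM ?ltW// -[c * x - _]mulrBr powRB ?(gt_eqF c0)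
  ?implybT//.
rewrite (powRr1 (ltW c0)).
have xy' : x - y != 0 by rewrite subr_eq0.
by field; rewrite p0 xy' (gt_eqF c0).
Qed.

Lemma power_kernel_scale p c x y : p != 0 -> p != 1 -> 0 < c -> 0 < x -> 0 < y ->
  paired_kernel (power_fun p) (power_fun (1 - p)) (c * x) (c * y) =
  c^-1 * paired_kernel (power_fun p) (power_fun (1 - p)) x y.
Proof.
move=> p0 p1 c0 x0 y0; have p10 : 1 - p != 0 by rewrite subr_eq0 eq_sym.
rewrite /paired_kernel !dd_power_fun_scale// mulrACA -powRD; last first.
  by rewrite (gt_eqF c0) ?implybT.
by rewrite (_ : p - 1 + _ = -1) ?powR_inv1 ?ltW//; ring.
Qed.

Lemma log_kernel_scale c x y : 0 < c -> 0 < x -> 0 < y ->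
  paired_kernel (@id R) (@ln R) (c * x) (c * y) =
  c^-1 * paired_kernel (@id R) (@ln R) x y.
Proof.
move=> c0 x0 y0; rewrite /paired_kernel !dd_id !mul1r.
have [<-|xy] := eqVneq x y.
  have cx0 : 0 < c * x by rewrite mulr_gt0.
  by rewrite !(dd_is_derive (is_derive1_ln _))// invfM.
have cxy : c * x != c * y by rewrite (inj_eq (mulfI (lt0r_neq0 c0))).
rewrite !dd_neq// !lnM ?posrE// -[c * x - _]mulrBr.
have xy' : x - y != 0 by rewrite subr_eq0.
by field; rewrite xy' (gt_eqF c0).
Qed.

End ModelKernels.

(** * The differential of the functional calculus *)

Lemma ler_mx_entry_norm (K : numDomainType) m n (A : 'M[K]_(m, n)) i j :
  `|A i j| <= `|A|.
Proof.
suff h : `|A i j| <= mx_norm A by exact: h.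
rewrite mx_normE -[leLHS]nngE num_le.
exact: (le_bigmax _ (fun ij : 'I_m * 'I_n => (`|A ij.1 ij.2|%:nng)) (i, j)).
Qed.

(** * Entrywise bounds for complex matrices *)

Section MatrixBounds.
Local Open Scope complex_scope.
Local Open Scope sesquilinear_scope.
Variable R : realType.

Lemma cnorm_ge0 (z : R[i]) : 0 <= cnorm z.
Proof. by rewrite -ler0c cnormE. Qed.

Lemma cnormM (z w : R[i]) : cnorm (z * w) = cnorm z * cnorm w.
Proof. by apply: complexI; rewrite rmorphM !cnormE normrM. Qed.

Lemma cnormD (z w : R[i]) : cnorm (z + w) <= cnorm z + cnorm w.
Proof. by rewrite -lecR rmorphD !cnormE ler_normD. Qed.

Lemma cnorm_real (x : R) : cnorm x%:C = `|x|.
Proof. by rewrite /cnorm normc_def /= expr0n addr0 sqrtr_sqr. Qed.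

Lemma cnorm_conj (z : R[i]) : cnorm (Num.conj z) = cnorm z.
Proof. by apply: complexI; rewrite !cnormE norm_conjC. Qed.

Lemma cnorm0 : cnorm (0 : R[i]) = 0.
Proof. by rewrite (cnorm_real 0) normr0. Qed.

Lemma cnorm_sum (I : finType) (F : I -> R[i]) :
  cnorm (\sum_i F i) <= \sum_i cnorm (F i).
Proof.
elim/big_rec2 : _ => [|i a b _ le]; first by rewrite cnorm0.
by apply: le_trans (cnormD _ _) _; rewrite lerD2l.
Qed.

(** A real-valued stand-in for the matrix norm, whose values lie in [R[i]]. *)
Definition mxbound m n (A : 'M[R[i]]_(m, n)) (a : R) := forall i j, cnorm (A i j) <= a.

Lemma mxbound_norm m n (A : 'M[R[i]]_(m, n)) : mxbound A (cnorm (`|A| : R[i])).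
Proof.
move=> i j; rewrite -lecR !cnormE normr_id.
exact: ler_mx_entry_norm.
Qed.

Lemma norm_mxbound m n (A : 'M[R[i]]_(m, n)) (a : R) : 0 <= a -> mxbound A a ->
  `|A| <= a%:C.
Proof.
move=> a0 Aa; suff h : mx_norm A <= a%:C by exact: h.
have [->|/mx_norm_neq0[[i j] ->]] := eqVneq (mx_norm A) 0.
  by rewrite ler0c.
by rewrite -cnormE lecR Aa.
Qed.

Lemma mxbound_mul m n p (A : 'M[R[i]]_(m, n)) (B : 'M[R[i]]_(n, p)) a b :
  mxbound A a -> mxbound B b -> mxbound (A *m B) (n%:R * (a * b)).
Proof.
move=> Aa Bb i j; rewrite mxE; apply: le_trans (cnorm_sum _) _.
rewrite mulr_natl -[X in _ *+ X]card_ord -sumr_const; apply: ler_sum => k _.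
by rewrite cnormM ler_pM ?cnorm_ge0.
Qed.

Lemma unitary_sum_sqr n (U : 'M[R[i]]_n) i : U *m U^t* = 1%:M ->
  \sum_j cnorm (U i j) ^+ 2 = 1.
Proof.
move=> UU; apply: complexI; rewrite rmorph_sum.
have := congr1 (fun A : 'M[R[i]]_n => A i i) UU; rewrite !mxE eqxx => UUi.
apply: etrans UUi.
by apply: eq_bigr => j _; rewrite rmorphXn !mxE -normCK.
Qed.

Lemma mxbound_unitary n (U : 'M[R[i]]_n) : U *m U^t* = 1%:M -> mxbound U 1.
Proof.
move=> UU i j; rewrite -(ler_pXn2r (_ : 0 < 2)%N) ?nnegrE ?cnorm_ge0// expr1n.
rewrite -(unitary_sum_sqr i UU) (bigD1 j)//= lerDl sumr_ge0// => k _.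
by rewrite exprn_ge0// cnorm_ge0.
Qed.

Lemma mxbound_adj m n (A : 'M[R[i]]_(m, n)) a : mxbound A a -> mxbound (A^t*) a.
Proof. by move=> Aa i j; rewrite !mxE cnorm_conj. Qed.

Lemma mxnormE m n (A : 'M[R[i]]_(m, n)) : `|A| = (cnorm (`|A| : R[i]))%:C.
Proof. by rewrite cnormE normr_id. Qed.

(** Each product of two coordinates is at most the mean of their squares. *)
Lemma qform_bound n (G : 'M[R[i]]_n) (w : 'rV[R[i]]_n) g : 0 <= g -> mxbound G g ->
  cnorm (qform G w) <= g * n%:R * \sum_i cnorm (w 0 i) ^+ 2.
Proof.
move=> g0 Gg; rewrite qformE mxE.
apply: le_trans (cnorm_sum _) _.
apply: le_trans (_ : \sum_j \sum_i g * ((cnorm (w 0 i) ^+ 2 + cnorm (w 0 j) ^+ 2)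
  / 2) <= _).
  apply: ler_sum => j _; rewrite cnormM [(w^t*) j 0]mxE [w^T j 0]mxE cnorm_conj mxE.
  apply: le_trans (ler_wpM2r (cnorm_ge0 _) (cnorm_sum _)) _.
  rewrite mulr_suml; apply: ler_sum => i _; rewrite cnormM.
  apply: le_trans (_ : g * (cnorm (w 0 i) * cnorm (w 0 j)) <= _).
    by rewrite mulrA [g * _]mulrC ler_wpM2r ?cnorm_ge0// ler_wpM2l ?cnorm_ge0.
  rewrite ler_wpM2l//; have := sqr_ge0 (cnorm (w 0 i) - cnorm (w 0 j)); rewrite
    sqrrB; lra.
rewrite le_eqVlt; apply/orP; left; apply/eqP.
under eq_bigr do rewrite -mulr_sumr -mulr_suml big_split/= sumr_const card_ord.
rewrite -mulr_sumr -mulr_suml big_split/= sumr_const card_ord sumrMnl.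
by rewrite -[X in X + X]mulr_natr; field.
Qed.

End MatrixBounds.

(** * The Daletskii-Krein formula with a uniform error bound *)

Section DaletskiiKrein.
Local Open Scope complex_scope.
Local Open Scope sesquilinear_scope.
Local Open Scope classical_set_scope.
Variables (R : realType) (n : nat).
Implicit Types (rho sigma H : 'M[R[i]]_n) (phi : R -> R).

(** Using the eigenbasis of [rho] on the left and that of [sigma] on the right diagonalises both
    terms at once, although the matrices need not commute. With [phi = id] it describes
    [sigma - rho] itself. *)
Lemma mxfunB_coord phi rho sigma i j :
  (spectralmx rho *m (mxfun phi sigma - mxfun phi rho) *m (spectralmx sigma)^t*) i j =
  (phi (speceig sigma j) - phi (speceig rho i))%:C *
    (spectralmx rho *m (spectralmx sigma)^t*) i j.
Proof.
rewrite mulmxBr mulmxBl !mxfunE.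
set U := spectralmx rho; set V := spectralmx sigma.
have -> : U *m (V^t* *m diag_mx (\row_i (phi (speceig sigma i))%:C) *m V) *m V^t* =
    U *m V^t* *m diag_mx (\row_i (phi (speceig sigma i))%:C).
  by rewrite !mulmxA -[_ *m V *m V^t*]mulmxA spectralmxKl mulmx1.
have -> : U *m (U^t* *m diag_mx (\row_i (phi (speceig rho i))%:C) *m U) *m V^t* =
    diag_mx (\row_i (phi (speceig rho i))%:C) *m (U *m V^t*).
  by rewrite !mulmxA spectralmxKl mul1mx.
rewrite mul_mx_diag mul_diag_mx; move: (U *m V^t*) => W.
by rewrite !mxE rmorphB mulrBl mulrC.
Qed.

Lemma mxfunLR_coord (c : R -> R -> R) rho (V : 'M[R[i]]_n) H i j :
  (spectralmx rho *m mxfunLR c rho H *m V^t*) i j =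
  \sum_k (c (speceig rho i) (speceig rho k))%:C *
    ((spectralmx rho *m H *m (spectralmx rho)^t*) i k *
     (spectralmx rho *m V^t*) k j).
Proof.
rewrite mxfunLRE; set U := spectralmx rho.
rewrite !mulmxA spectralmxKl mul1mx -mulmxA; move: (U *m H *m U^t*) (U *m V^t*) => G W.
by rewrite mxE; apply: eq_bigr => k _; rewrite mxE mulrA.
Qed.

(** There are finitely many pairs of eigenvalues, so continuity at each of them yields a common
    [d]. *)
Lemma dd_equicontinuous phi rho (e : R) :
  (forall x, 0 < x -> derivable phi x 1) -> (forall i, 0 < speceig rho i) -> 0 < e ->
  exists2 d : R, 0 < d & forall i k (mu : R), `|speceig rho k - mu| < d ->
    `|dd phi (speceig rho i) (speceig rho k) - dd phi (speceig rho i) mu| <= e.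
Proof.
move=> dphi rho0 e0; pose Q i k (d : R) := forall mu : R, `|speceig rho k - mu| < d ->
  `|dd phi (speceig rho i) (speceig rho k) - dd phi (speceig rho i) mu| <= e.
suff [d [d0 Qd]] : exists d : R, 0 < d /\ forall i k, Q i k d.
  by exists d => // i k mu; exact: Qd.
apply: (@filter_ex _ (0 : R)^'+); apply: filterI; first exact: nbhs_right_gt.
apply: (@filter_forall _ _ (fun i d => forall k, Q i k d) (0 : R)^'+ _) => i.
apply: (@filter_forall _ _ (Q i) (0 : R)^'+ _) => k; rewrite /Q.
have c : {for speceig rho k, continuous (dd phi (speceig rho i))}.
  apply: continuous_dd => [|_]; last exact: dphi.
  exact/differentiable_continuous/derivable1_diffP/dphi.
have /cvgrPdist_le/(_ _ e0)/nbhs_ballP[r /= r0 rP] := c.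
near=> d => mu mud; apply: rP; apply: lt_le_trans mud _.
by near: d; exact: nbhs_right_le.
Unshelve. all: by end_near. Qed.

(* With U, V the eigenbases of rho, sigma and W = U V^*, the entry (i, j) of
   U (phi sigma - phi rho - D (sigma - rho)) V^* is the sum over k of
   (phi[l_i, m_j] - phi[l_i, l_k]) (U (sigma - rho) U^* )_ik W_kj, and
   (m_j - l_k) W_kj is of the order of sigma - rho: either m_j is close to l_k
   or W_kj is small. *)
Lemma mxfun_differential_bound phi rho (e : R) :
  rho \is hermsymmx -> (forall i, 0 < speceig rho i) ->
  (forall x, 0 < x -> derivable phi x 1) -> 0 < e ->
  exists2 d : R, 0 < d & forall sigma h, sigma \is hermsymmx ->
    mxbound (sigma - rho) h -> 0 <= h < d ->
    mxbound (mxfun phi sigma - mxfun phi rho - mxfunLR (dd phi) rho (sigma - rho))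
      (e * h).
Proof.
move=> rhoh rho0 dphi e0; set N : R := n%:R.
have N0 : 0 <= N by rewrite ler0n.
(* The five factors [N]: two from conjugating [sigma - rho] by [U], one from the sum over [k], two
   from returning to the original basis. *)
pose e1 := e / (N ^+ 5 + 1).
have N51 : 0 < N ^+ 5 + 1 by rewrite ltr_wpDl// exprn_ge0.
have e10 : 0 < e1 by rewrite divr_gt0.
have [//|||d d0 dP] := @dd_equicontinuous phi rho (Order.min e1 1).
- exact: rho0.
- by rewrite lt_min e10 ltr01.
pose M := \sum_i \sum_k `|dd phi (speceig rho i) (speceig rho k)|.
have M0 : 0 <= M by rewrite sumr_ge0// => i _; rewrite sumr_ge0.
have MP i k : `|dd phi (speceig rho i) (speceig rho k)| <= M.
  rewrite /M (bigD1 i)//= (bigD1 k)//= -addrA lerDl addr_ge0// sumr_ge0// => a _.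
  by rewrite sumr_ge0.
have c1 : 0 < N ^+ 3 + 1 by rewrite ltr_wpDl// exprn_ge0.
have c2 : 0 < (2 * M + 1) * N ^+ 2 + 1.
  by rewrite ltr_wpDl// mulr_ge0 ?exprn_ge0// addr_ge0// mulr_ge0.
(* The first bound puts every eigenvalue of [sigma] within [d] of one of [rho]; the second makes the
   entries of [W] between distant eigenvalues negligible against [2 * M + 1]. *)
exists (Order.min (d / (N ^+ 3 + 1)) (e1 * d / ((2 * M + 1) * N ^+ 2 + 1))).
  by rewrite lt_min !divr_gt0// mulr_gt0.
move=> sigma h sigmah Hh /andP[h0]; rewrite lt_min => /andP[].
rewrite !ltr_pdivlMr// => hd1 hd2.
set U := spectralmx rho; set V := spectralmx sigma; set H := sigma - rho.
pose W := U *m V^t*.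
have UU := spectralmxKl rho; have VV := spectralmxKl sigma.
rewrite -/U -/V in UU VV.
have U1 := mxbound_unitary UU; have V1 := mxbound_unitary VV.
have W1 : W *m W^t* = 1%:M.
  by rewrite /W adjmxM trmxCK mulmxA -[_ *m V^t* *m V]mulmxA (mulmx1C VV) mulmx1.
have W2 := mulmx1C W1.
pose g := N * (N * (1 * h) * 1).
have gE : g = N ^+ 2 * h by rewrite /g; ring.
have g0 : 0 <= g by rewrite gE mulr_ge0// exprn_ge0.
pose G := U *m H *m U^t*.
have Gg : mxbound G g by apply: mxbound_mul (mxbound_adj U1); exact: mxbound_mul.
have UHV : U *m H *m V^t* = G *m W.
  by rewrite /G /W !mulmxA -[_ *m U^t* *m U]mulmxA (mulmx1C UU) mulmx1.
have UHVg : mxbound (U *m H *m V^t*) g.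
  by apply: mxbound_mul (mxbound_adj V1); exact: mxbound_mul.
have UHVE i j : (U *m H *m V^t*) i j = (speceig sigma j - speceig rho i)%:C * W i j.
  rewrite -(mxfunB_coord id rho sigma i j) -/U -/V.
  by rewrite (mxfun_id rhoh) (mxfun_id sigmah).
have near_eig i j : `|speceig rho i - speceig sigma j| * cnorm (W i j) <= g.
  by rewrite distrC -cnorm_real -cnormM -UHVE.
(* Column [j] of [W] is a unit vector; were all eigenvalues of [rho] far away, all its entries would
   be small. This is what bounds the divided differences at eigenvalues of [sigma]. *)
have ex_near j : exists k, `|speceig rho k - speceig sigma j| < d.
  apply/existsP; apply: contraT; rewrite negb_exists => /forallP far.
  have Wd k : d * cnorm (W k j) <= g.
    apply: le_trans (near_eig k j); rewrite ler_wpM2r ?cnorm_ge0//.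
    by rewrite leNgt far.
  have col : \sum_k cnorm (W k j) ^+ 2 = 1.
    have : W^t* *m W^t*^t* = 1%:M by rewrite trmxCK.
    move=> /(unitary_sum_sqr j) <-; apply: eq_bigr => k _.
    by rewrite !mxE cnorm_conj.
  have : d <= N * g.
    rewrite -[d]mulr1 -col mulr_sumr mulr_natl -[X in _ *+ X]card_ord -sumr_const.
    apply: ler_sum => k _; apply: le_trans (Wd k); rewrite ler_wpM2l ?(ltW d0)//.
    rewrite expr2 ler_piMl ?cnorm_ge0//; exact: (mxbound_unitary W1).
  rewrite leNgt => /negP[]; apply: le_lt_trans hd1.
  by rewrite gE mulrDr mulr1 (_ : N * _ = h * N ^+ 3) ?lerDl//; ring.
have ddM i j : `|dd phi (speceig rho i) (speceig sigma j)| <= M + 1.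
  have [k kj] := ex_near j; have := dP i k _ kj; rewrite le_min => /andP[_].
  rewrite distrC => le1; rewrite -[X in `|X|](subrK (dd phi (speceig rho i)
    (speceig rho k))).
  by rewrite addrC (le_trans (ler_normD _ _))// lerD.
pose D i j k := dd phi (speceig rho i) (speceig sigma j) - dd phi (speceig rho i)
  (speceig rho k).
have Dle i j k : `|D i j k| * cnorm (W k j) <= e1.
  have [kj|kj] := ltP `|speceig rho k - speceig sigma j| d.
    have := dP i k _ kj; rewrite le_min distrC => /andP[De _].
    rewrite -[leRHS]mulr1 ler_pM ?cnorm_ge0//; exact: (mxbound_unitary W1).
  have DM : `|D i j k| <= 2 * M + 1.
    by rewrite (le_trans (ler_normB _ _))// (le_trans (lerD (ddM _ _) (MP _ _)))//; lra.
  rewrite -(ler_pM2r d0) -mulrA [cnorm _ * d]mulrC.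
  apply: le_trans (_ : (2 * M + 1) * g <= _).
    apply: ler_pM => //; first by rewrite mulr_ge0 ?cnorm_ge0// ltW.
    apply: le_trans (near_eig k j); rewrite ler_wpM2r ?cnorm_ge0//.
  rewrite ltW//; apply: le_lt_trans hd2.
  rewrite gE [leLHS](_ : _ = h * ((2 * M + 1) * N ^+ 2)); last by ring.
  by rewrite [leRHS]mulrDr mulr1 lerDl.
set X := mxfun phi sigma - mxfun phi rho - mxfunLR (dd phi) rho H.
pose E := U *m X *m V^t*.
have EE i j : E i j = \sum_k (D i j k)%:C * (G i k * W k j).
  rewrite /E /X mulmxBr mulmxBl [LHS]mxE mxfunB_coord [X in _ + X]mxE mxfunLR_coord.
  rewrite ddE [dd _ _ _]ddC rmorphM -mulrA -/U -/V -/W -UHVE UHV [(G *m W) i j]mxE.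
  rewrite mulr_sumr -sumrB; apply: eq_bigr => k _.
  by rewrite -mulrBl -rmorphB.
have Eb : mxbound E (N * (g * e1)).
  move=> i j; rewrite EE; apply: le_trans (cnorm_sum _) _.
  rewrite mulr_natl -[X in _ *+ X]card_ord -sumr_const; apply: ler_sum => k _.
  rewrite !cnormM cnorm_real mulrCA ler_pM ?mulr_ge0 ?cnorm_ge0//.
have XE : X = U^t* *m E *m V.
  rewrite /E !mulmxA (mulmx1C UU) mul1mx -mulmxA (mulmx1C VV) mulmx1//.
move=> i j; rewrite XE.
apply: le_trans (mxbound_mul (mxbound_mul (mxbound_adj U1) Eb) V1 i j) _.
rewrite -/N gE [leLHS](_ : _ = N ^+ 5 * (e1 * h)); last by ring.
rewrite mulrA ler_wpM2r// /e1 mulrA ler_pdivrMr// mulrC ler_wpM2l ?(ltW e0)//.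
by rewrite lerDl.
Qed.

End DaletskiiKrein.

(** * Existence and uniqueness of the differential on density matrices *)

Section Differential.
Local Open Scope complex_scope.
Local Open Scope sesquilinear_scope.
Local Open Scope classical_set_scope.
Variables (R : realType) (n : nat).
Implicit Types (rho sigma H A B : 'M[R[i]]_n) (phi : R -> R).

Lemma density_hermsymmx rho : density rho -> rho \is hermsymmx.
Proof. by case=> -[]. Qed.

Lemma density_speceig_gt0 rho i : density rho -> 0 < speceig rho i.
Proof. by move=> [/posdefmx_speceig_gt0]. Qed.

Lemma density_speceig_sum rho : density rho -> \sum_i speceig rho i = 1.
Proof.
move=> dr; apply: complexI; rewrite (speceig_sum (density_hermsymmx dr)).
by case: dr.
Qed.

Lemma mxfunLRD_linear (c : R -> R -> R) rho (a : R[i]) A B :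
  mxfunLR c rho (a *: A + B) = a *: mxfunLR c rho A + mxfunLR c rho B.
Proof.
rewrite !mxfunLRE scalemxAl scalemxAr -mulmxDl -mulmxDr.
apply: congr_mulmx2; rewrite mulmxDr mulmxDl -scalemxAr -scalemxAl.
move: (_ *m A *m _) (_ *m B *m _) => A' B'.
by apply/matrixP => i j; rewrite !mxE mulrDr mulrCA.
Qed.

Lemma is_differential_dd phi rho : (forall x, 0 < x -> derivable phi x 1) ->
  density rho -> is_differential phi rho (mxfunLR (dd phi) rho).
Proof.
move=> dphi dr; split=> [a M N _ _|e]; first exact: mxfunLRD_linear.
rewrite ltcE /= => /andP[/eqP e_im e_re].
have [d d0 dP] := mxfun_differential_bound (density_hermsymmx dr)
  (fun i => density_speceig_gt0 i dr) dphi e_re.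
exists d%:C; first by rewrite ltcR.
move=> sigma dsigma; rewrite mxnormE ltcR => sd.
have -> : e = (complex.Re e)%:C by case: e e_im {e_re dP} => a b /= ->.
rewrite -rmorphM; apply: norm_mxbound; first by rewrite mulr_ge0 ?cnorm_ge0// ltW.
apply: dP; [exact: density_hermsymmx|exact: mxbound_norm|by rewrite cnorm_ge0].
Qed.

Lemma tangent0 : tangent (0 : 'M[R[i]]_n).
Proof.
split; last by rewrite mxtrace0.
by apply/hermsymmxP; apply/matrixP => i j; rewrite !mxE conjC0.
Qed.

Lemma is_differentialZ phi rho D (t : R) H : is_differential phi rho D ->
  tangent H -> D (t%:C *: H) = t%:C *: D H.
Proof.
move=> [lin _] tH; have t0 := tangent0.
have D0 : D 0 = 0.
  have := lin 1 0 0 t0 t0; rewrite scaler0 addr0 scale1r => /eqP.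
  by rewrite -subr_eq0 opprD addNKr oppr_eq0 => /eqP.
by have := lin t H 0 tH t0; rewrite !addr0 D0 addr0.
Qed.

(** The least eigenvalue of [rho] absorbs the perturbation. Both forms are measured against the same
    squared norm [s] of the coordinates of [v] in the eigenbasis of [rho]. *)
Lemma density_perturb rho H : density rho -> tangent H ->
  exists2 t0 : R, 0 < t0 & forall t, 0 < t < t0 -> density (rho + t%:C *: H).
Proof.
move=> dr [Hh H0]; have rhoh := density_hermsymmx dr.
set U := spectralmx rho; pose G := U *m H *m U^t*.
pose w (v : 'rV[R[i]]_n) := v *m U^t*.
have wU v : w v *m U = v by rewrite /w -mulmxA spectralmxKr mulmx1.
have [m [m0 mP]] : exists m : R, 0 < m /\ forall i, m <= speceig rho i.
  apply: (@filter_ex _ (0 : R)^'+); apply: filterI; first exact: nbhs_right_gt.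
  apply: (@filter_forall _ _ (fun i m => m <= speceig rho i) (0 : R)^'+ _) => i.
  by apply: nbhs_right_le; exact: density_speceig_gt0.
pose g := cnorm (`|G| : R[i]); have g0 : 0 <= g by exact: cnorm_ge0.
have gn0 : 0 < g * n%:R + 1 by rewrite ltr_wpDl// mulr_ge0.
exists (m / (g * n%:R + 1)); first by rewrite divr_gt0.
move=> t /andP[t0]; rewrite ltr_pdivlMr// => tm.
have tHh : t%:C *: H \is hermsymmx.
  apply/hermsymmxP; rewrite -[in RHS](hermsymmxP _ Hh).
  apply/matrixP => i j; rewrite !mxE rmorphM; congr (_ * _).
  by apply: conj_Creal; apply/complex_realP; exists t.
split; last by rewrite mxtraceD mxtraceZ H0 mulr0 addr0; case: dr.
split.
  apply/hermsymmxP; rewrite -[in RHS](hermsymmxP _ rhoh) -[in RHS](hermsymmxP _ tHh).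
  by apply/matrixP => i j; rewrite !mxE rmorphD.
move=> v v0; rewrite -qformE.
pose s := \sum_i cnorm (w v 0 i) ^+ 2.
have s0 : 0 < s.
  rewrite lt_def sumr_ge0 ?andbT => [|i _]; last by rewrite exprn_ge0 ?cnorm_ge0.
  apply: contraNneq v0 => /eqP; rewrite psumr_eq0 => [/allP h|i _]; last first.
    by rewrite exprn_ge0 ?cnorm_ge0.
  rewrite -(wU v) (_ : w v = 0) ?mul0mx//; apply/rowP => i; rewrite [RHS]mxE.
  have := h i (mem_index_enum _); rewrite /= expf_eq0 /= => /eqP c0.
  by apply/eqP; rewrite -normr_eq0 -cnormE c0.
have [a aE am] : exists2 a : R, qform rho v = a%:C & m * s <= a.
  exists (\sum_i speceig rho i * cnorm (w v 0 i) ^+ 2).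
    by rewrite -{1}(mxfun_id rhoh); exact: (qform_mxfun id).
  rewrite mulr_sumr; apply: ler_sum => i _; rewrite ler_wpM2r ?exprn_ge0 ?cnorm_ge0//.
have [b bE] : exists b : R, qform H v = b%:C.
  by rewrite -(mxfun_id Hh); eexists; exact: qform_mxfun.
have bg : `|b| <= g * n%:R * s.
  rewrite -cnorm_real -bE (_ : qform H v = qform G (w v)).
    exact: qform_bound g0 (mxbound_norm _).
  rewrite !qformE /w /G adjmxM trmxCK !mulmxA -[v *m U^t* *m U]mulmxA spectralmxKr.
  by rewrite mulmx1 -[_ *m U^t* *m U]mulmxA spectralmxKr mulmx1.
have qZ : qform (t%:C *: H) v = (t * b)%:C.
  by rewrite qformE -scalemxAr -scalemxAl mxE -qformE bE rmorphM.
rewrite qformD aE qZ -rmorphD ltcR.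
have tb : - (t * `|b|) <= t * b by rewrite -mulrN ler_wpM2l ?(ltW t0)// lerNl
  ler_normr lexx orbT.
have : t * `|b| <= t * (g * n%:R * s) by rewrite ler_wpM2l// ltW.
have : t * (g * n%:R + 1) * s < m * s by rewrite ltr_pM2r.
have : 0 < t * s by rewrite mulr_gt0.
rewrite mulrDr mulrDl mulr1 !mulrA; lra.
Unshelve. all: by end_near. Qed.

(** The metric condition only asserts that some differentials exist; uniqueness identifies them with
    the divided-difference formula. *)
Lemma is_differential_unique phi rho D1 D2 H : density rho -> tangent H ->
  is_differential phi rho D1 -> is_differential phi rho D2 -> D1 H = D2 H.
Proof.
move=> dr tH d1 d2; apply/eqP; rewrite -subr_eq0 -normr_eq0; apply: contraT => a0.
pose a := cnorm (`|D1 H - D2 H| : R[i]); pose b := cnorm (`|H| : R[i]).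
have aE : `|D1 H - D2 H| = a%:C by exact: mxnormE.
have bE : `|H| = b%:C by exact: mxnormE.
have {}a0 : 0 < a by rewrite lt_def cnorm_ge0 andbT; apply: contraNneq a0;
  rewrite aE => ->.
have b0 : 0 <= b by exact: cnorm_ge0.
(* The two errors together are [2 * e * b] times [t], less than [t * a]; [b + 1] covers the case
   [H = 0]. *)
pose e := a / (4 * (b + 1)).
have e0 : 0 < e by rewrite divr_gt0// mulr_gt0// ltr_wpDl.
have eC : 0 < e%:C by rewrite ltcR.
have [u1 u10 h1] := d1.2 _ eC; have [u2 u20 h2] := d2.2 _ eC.
have [t0 t00 ht] := density_perturb dr tH.
have b10 : 0 < b + 1 by rewrite ltr_wpDl.
have Re_gt0 (z : R[i]) : 0 < z -> 0 < complex.Re z /\ z = (complex.Re z)%:C.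
  by case: z => x y; rewrite ltcE /= => /andP[/eqP-> ->].
have [v10 u1E] := Re_gt0 _ u10; have [v20 u2E] := Re_gt0 _ u20.
have [t [/andP[tp tt0] [t1 t2]]] : exists t : R, 0 < t < t0 /\
    (t * (b + 1) < complex.Re u1 /\ t * (b + 1) < complex.Re u2).
  apply: (@filter_ex _ (0 : R)^'+); near=> t; split; [|split].
  - by apply/andP; split.
  - by rewrite -ltr_pdivlMr//; near: t; apply: nbhs_right_lt; rewrite divr_gt0.
  - by rewrite -ltr_pdivlMr//; near: t; apply: nbhs_right_lt; rewrite divr_gt0.
have dt : density (rho + t%:C *: H) by apply: ht; rewrite tp.
have tb : t * b < t * (b + 1) by rewrite ltr_pM2l// ltrDl.
have sE : rho + t%:C *: H - rho = t%:C *: H by rewrite addrC addKr.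
have nt : `|t%:C *: H| = (t * b)%:C.
  by rewrite normrZ bE ger0_norm ?rmorphM// ler0c ltW.
have := h1 _ dt; rewrite sE nt u1E ltcR => /(_ (lt_trans tb t1)).
have := h2 _ dt; rewrite sE nt u2E ltcR => /(_ (lt_trans tb t2)).
rewrite (is_differentialZ _ d1 tH) (is_differentialZ _ d2 tH).
set X := mxfun phi _ - mxfun phi rho => l2 l1.
have : `|t%:C *: (D1 H - D2 H)| <= e%:C * (t * b)%:C + e%:C * (t * b)%:C.
  rewrite scalerBr -[X in `|X|](_ : (X - t%:C *: D2 H) - (X - t%:C *: D1 H) = _).
    by apply: le_trans (ler_normB _ _) _; exact: lerD.
  by rewrite opprB addrC subrKA.
rewrite normrZ aE ger0_norm ?ler0c ?(ltW tp)// -!rmorphM -rmorphD lecR.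
have -> : e * (t * b) + e * (t * b) = t * (2 * e * b) by ring.
rewrite ler_pM2l// /e => le.
suff : 2 * (a / (4 * (b + 1))) * b < a by rewrite ltNge le.
have -> : 2 * (a / (4 * (b + 1))) * b = a * (2 * b / (4 * (b + 1))).
  by field; rewrite gt_eqF.
rewrite gtr_pMr// ltr_pdivrMr ?mulr_gt0//; lra.
Unshelve. all: by end_near. Qed.

End Differential.

Section Traces.
Local Open Scope complex_scope.
Local Open Scope sesquilinear_scope.
Variables (R : realType) (n : nat).
Implicit Types (rho A B : 'M[R[i]]_n) (c : R -> R -> R).

Lemma mxtrace_mulE A B : \tr (A *m B) = \sum_i \sum_j A i j * B j i.
Proof. by apply: eq_bigr => i _; rewrite mxE. Qed.

(** The trace pairs the entry [(i, j)] of one factor with the entry [(j, i)] of the other, hence the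
    exchanged arguments. *)
Lemma mxtrace_mxfunLR c1 c2 c rho A B :
  (forall i j, c1 (speceig rho i) (speceig rho j) * c2 (speceig rho j) (speceig rho i) =
     c (speceig rho j) (speceig rho i)) ->
  \tr (mxfunLR c1 rho A *m mxfunLR c2 rho B) = \tr (A *m mxfunLR c rho B).
Proof.
move=> cE; rewrite !mxfunLRE; set U := spectralmx rho.
have UU : U *m U^t* = 1%:M := spectralmxKl rho.
have E X Y : \tr (U^t* *m X *m U *m (U^t* *m Y *m U)) = \tr (X *m Y).
  by rewrite !mulmxA (mulmxtVK _ (spectral_unitarymx rho)) mxtrace_mulC !mulmxA
    UU mul1mx.
have E' X Y : \tr (X *m (U^t* *m Y *m U)) = \tr (U *m X *m U^t* *m Y).
  by rewrite !mulmxA mxtrace_mulC !mulmxA.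
apply: (etrans (E _ _)); apply: (etrans _ (esym (E' _ _))).
rewrite !mxtrace_mulE.
apply: eq_bigr => i _; apply: eq_bigr => j _.
move: (U *m A *m U^t*) (U *m B *m U^t*) => A' B'.
by rewrite !mxE -cE rmorphM; ring.
Qed.

(** The eigenbasis [U] of a diagonal matrix may permute or mix coordinates, but [U i j] is nonzero
    only where the [i]-th eigenvalue is [d j], so [c] can be evaluated at the diagonal entries. *)
Lemma mxfunLR_diag c (d : 'I_n -> R) B k l :
  mxfunLR c (diag_mx (\row_i (d i)%:C)) B k l = (c (d k) (d l))%:C * B k l.
Proof.
set rho := diag_mx _; have rhoh : rho \is hermsymmx.
  apply/hermsymmxP; rewrite tr_diag_mx map_diag_mx; congr diag_mx.
  apply/rowP => i; rewrite !mxE; apply: conj_Creal; apply/complex_realP.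
  by exists (d i).
rewrite mxfunLRE; set U := spectralmx rho.
have UrhoE i j : U i j != 0 -> speceig rho i = d j.
  move=> Uij; apply: complexI; apply: (mulfI Uij).
  have := congr1 (fun A : 'M[R[i]]_n => A i j) (congr1 (mulmx U)
    (hermsymmx_spectralE rhoh)).
  rewrite !mulmxA spectralmxKl mul1mx -/U {1}/rho mul_mx_diag mul_diag_mx !mxE => ->.
  by rewrite mulrC.
have BE : B = U^t* *m (U *m B *m U^t*) *m U.
  by rewrite !mulmxA spectralmxKr mul1mx -mulmxA spectralmxKr mulmx1.
rewrite {2}BE; move: (U *m B *m U^t*) => G.
rewrite ![(_ *m U) k l]mxE mulr_sumr; apply: eq_bigr => j _.
rewrite ![(U^t* *m _) k j]mxE !mulr_suml mulr_sumr; apply: eq_bigr => i _.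
rewrite ![(U^t*) k i]mxE [U^T k i]mxE [(\matrix_(_, _) _) i j]mxE.
have [->|Uik] := eqVneq (U i k) 0; first by rewrite conjC0 !mul0r mulr0.
have [->|Ujl] := eqVneq (U j l) 0; first by rewrite !mulr0.
by rewrite (UrhoE _ _ Uik) (UrhoE _ _ Ujl); ring.
Qed.

Lemma mxfunLR0 c rho : mxfunLR c rho 0 = 0.
Proof.
rewrite mxfunLRE mulmx0 mul0mx [X in _ *m X *m _](_ : _ = 0) ?mulmx0 ?mul0mx//.
by apply/matrixP => i j; rewrite !mxE mulr0.
Qed.

End Traces.

Lemma density_speceig_lt1 (R : realType) (n : nat) (rho : 'M[R[i]]_n) i :
  density rho -> n != 1%N -> speceig rho i < 1.
Proof.
move=> dr n1; have n0 : (1 < n)%N by case: n {rho dr} i n1 => [[]//|[]].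
have [j ij] : exists j, j != i.
  apply/existsP; apply: contraT; rewrite negb_exists => /forallP all_i.
  have : (#|'I_n| <= 1)%N.
    by apply/card_le1_eqP => a b _ _; have := all_i a; have := all_i b;
      rewrite !negbK => /eqP -> /eqP ->.
  by rewrite card_ord leqNgt n0.
rewrite -(density_speceig_sum dr) (bigD1 i)//= ltrDl (bigD1 j)//=.
rewrite ltr_wpDr ?density_speceig_gt0// sumr_ge0// => k _.
by rewrite ltW// density_speceig_gt0.
Qed.

Lemma induces_paired_of_kernel (R : realType) (phi chi : R -> R) (K : R -> R -> R) :
  (forall x, 0 < x -> derivable phi x 1) -> (forall x, 0 < x -> derivable chi x 1) ->
  (forall c x y, 0 < c -> 0 < x -> 0 < y -> K (c * x) (c * y) = c^-1 * K x y) ->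
  (forall x y, K x y = K y x) -> stieltjes (K 1) -> K 1 1 = 1 ->
  (forall x y, 0 < x < 1 -> 0 < y < 1 -> paired_kernel phi chi x y = K x y) ->
  induces_paired_monotone_metric phi chi.
Proof.
move=> dphi dchi Ks KC KS K11 KE; have K0 t : 0 < t -> 0 < K 1 t by exact:
  stieltjes_gt0.
(* By homogeneity and symmetry, [c_f(x, y) = K(1, x/y) / y = K(x, y)] for this [f]. *)
exists (fun t => (K 1 t)^-1); split.
- exact: (operator_monotone_stieltjesV KS).
- move=> x x0; have := Ks x^-1 x 1 ltac:(by rewrite invr_gt0) x0 ltr01.
  rewrite mulVf ?gt_eqF// mulr1 invrK => ->; rewrite KC invfM mulrA divff ?mul1r//.
  by rewrite gt_eqF.
- by rewrite K11 invr1.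
move=> n rho dr; exists (mxfunLR (dd phi) rho), (mxfunLR (dd chi) rho).
split; [exact: is_differential_dd|exact: is_differential_dd|move=> A B [_ A0] _].
(* In size 1 the eigenvalue is 1, outside the range of the kernel hypothesis, but the only tangent
   vector is 0. *)
have [n1|n1] := eqVneq n 1%N.
  subst n; have -> : A = 0.
    by rewrite [A]mx11_scalar; move: A0; rewrite trace_mx11 => ->; rewrite raddf0.
  by rewrite mxfunLR0 !mul0mx.
apply: mxtrace_mxfunLR => i j.
have li := density_speceig_gt0 i dr; have lj := density_speceig_gt0 j dr.
have li1 := density_speceig_lt1 i dr n1; have lj1 := density_speceig_lt1 j dr n1.
rewrite [dd chi _ _]ddC -/(paired_kernel _ _ _ _) KE ?li ?lj//.
rewrite /chentsov_morozova div1r invfM invrK -Ks ?divr_gt0//.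
by rewrite mulr1 mulrCA divff ?mulr1// gt_eqF.
Qed.

Lemma chentsov_morozovaC (R : realType) (f : R -> R) x y :
  symmetric_fun f -> 0 < x -> 0 < y ->
  chentsov_morozova f x y = chentsov_morozova f y x.
Proof.
move=> fs x0 y0; rewrite /chentsov_morozova (fs (x / y)) ?divr_gt0// invf_div.
by rewrite mulrA mulrCA divff ?mulr1 // gt_eqF.
Qed.

(** * Diagonal test matrices *)

Section DiagonalStates.
Local Open Scope complex_scope.
Local Open Scope sesquilinear_scope.
Variable R : realType.

Lemma posdefmx_diag n (d : 'I_n -> R) : (forall i, 0 < d i) ->
  posdefmx (diag_mx (\row_i (d i)%:C)).
Proof.
move=> d0; split.
  apply/hermsymmxP; rewrite tr_diag_mx map_diag_mx; congr diag_mx.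
  apply/rowP => i; rewrite !mxE; apply: conj_Creal; apply/complex_realP.
  by exists (d i).
move=> v v0; rewrite mul_mx_diag mxE.
have F i : 0 <= (\matrix_(i0, j) (v i0 j * (\row_i1 (d i1)%:C) 0 j)) 0 i * (v^t*)
  i 0 :> R[i].
  rewrite !mxE mulrAC mulr_ge0 ?mul_conjC_ge0// ler0c ltW//.
rewrite lt_def sumr_ge0 ?andbT//; apply: contraNneq v0 => /eqP.
rewrite psumr_eq0// => /allP h; apply/eqP/rowP => i; rewrite [RHS]mxE.
have := h i (mem_index_enum _); rewrite /= !mxE mulrAC mulf_eq0 -normCK.
rewrite expf_eq0 /= normr_eq0 => /orP[/eqP//|/eqP]; rewrite -[0]/(0%:C) => /complexI.
by move=> di0; have := d0 i; rewrite di0 ltxx.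
Qed.

Lemma density_diag n (d : 'I_n -> R) : (forall i, 0 < d i) -> \sum_i d i = 1 ->
  density (diag_mx (\row_i (d i)%:C)).
Proof.
move=> d0 d1; split; first exact: posdefmx_diag.
rewrite mxtrace_diag -[1]/(1%:C) -d1 rmorph_sum; apply: eq_bigr => i _.
by rewrite mxE.
Qed.

(** Size 1 suffices; values are read through the trace, which does not depend on the chosen
    eigenbasis. *)
Lemma operator_monotone_le (f : R -> R) x y : operator_monotone f ->
  0 < x -> x < y -> f x <= f y.
Proof.
move=> fm x0 xy; pose D (z : R) : 'M[R[i]]_1 := diag_mx (\row_i z%:C).
have Dp z : 0 < z -> posdefmx (D z) by move=> z0; exact: (@posdefmx_diag _ (fun=> z)).
have DB : D y - D x = D (y - x).
  by apply/matrixP => i j; rewrite !mxE !ord1 eqxx !mulr1n rmorphB.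
have eigD z : 0 < z -> speceig (D z) 0 = z.
  move=> /Dp[Dh _]; apply: complexI; have := speceig_sum Dh.
  by rewrite big_ord1 => ->; rewrite trace_mx11 !mxE eqxx mulr1n.
have trD z : 0 < z -> \tr (mxfun f (D z)) = (f z)%:C.
  by move=> z0; apply: etrans (mxtrace_mxfun f (D z)) _; rewrite big_ord1 eigD.
have le (A B : 'M[R[i]]_1) (a b : R) :
    \tr A = a%:C -> \tr B = b%:C -> possemidefmx (B - A) -> a <= b.
  move=> Aa Bb [_ /(_ 1%:M)]; rewrite mul1mx trmx1 map_mx1 mulmx1 -trace_mx11.
  by rewrite raddfB/= Aa Bb -rmorphB ler0c subr_ge0.
apply: le (trD x x0) (trD y (lt_trans x0 xy)) _.
apply: (fm 1%N (D x) (D y) (Dp _ x0) _).2.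
by rewrite DB; apply/posdefmxW/Dp; rewrite subr_gt0.
Qed.

(* On 2 x 2 matrices the eigenvalues would be tied by x + y = 1. *)
Lemma paired_metric_kernel (phi chi f : R -> R) x y :
  (forall x, 0 < x -> derivable phi x 1) -> (forall x, 0 < x -> derivable chi x 1) ->
  symmetric_fun f ->
  (forall rho : 'M[R[i]]_3, density rho ->
     exists Dphi Dchi : 'M[R[i]]_3 -> 'M[R[i]]_3,
       [/\ is_differential phi rho Dphi, is_differential chi rho Dchi &
        forall A B : 'M[R[i]]_3, tangent A -> tangent B ->
          \tr (Dphi A *m Dchi B) =
          \tr (A *m mxfunLR (chentsov_morozova f) rho B)]) ->
  0 < x -> 0 < y -> x + y < 1 ->
  paired_kernel phi chi x y = chentsov_morozova f x y.
Proof.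
move=> dphi dchi fs metric x0 y0 xy1.
pose d (i : 'I_3) : R := nth 0 [:: x; y; 1 - x - y] i.
pose rho := diag_mx (\row_i (d i)%:C).
have dr : density rho.
  apply: density_diag => [i|].
    by rewrite /d; case: i => -[|[|[|//]]] /= _; lra.
  rewrite /d /=.
  by rewrite !big_ord_recl big_ord0 /=; ring.
(* This off-diagonal direction, paired with itself, gives twice the kernel at [(x, y)]. The case
   [x = y] is included and yields the product of the derivatives. *)
have [Dphi [Dchi [Dp Dc /(_ (delta_mx 0 1 + delta_mx 1 0))]]] := metric _ dr.
set A := _ + _ => trE.
have tA : tangent A.
  split; last by rewrite /mxtrace !big_ord_recl big_ord0 !mxE /= !addr0.
  apply/hermsymmxP; apply/matrixP => i j; rewrite !mxE rmorphD !rmorph_nat addrC.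
  by move: (i == 0) (i == 1) (j == 0) (j == 1) => [] [] [] [].
have := trE A tA tA.
rewrite (is_differential_unique dr tA Dp (is_differential_dd dphi dr)).
rewrite (is_differential_unique dr tA Dc (is_differential_dd dchi dr)).
rewrite !mxtrace_mulE !big_ord_recl !big_ord0 !mxfunLR_diag !mxE /=.
rewrite /d /= !(addr0, add0r, mulr0, mul0r, mulr1, mul1r) -!rmorphM -!rmorphD.
move=> /complexI; rewrite /paired_kernel [dd phi y x]ddC [dd chi y x]ddC.
rewrite (chentsov_morozovaC fs y0 x0); lra.
Qed.

End DiagonalStates.

(** * Rigidity of the pair *)

Section DerivativeTools.
Variable R : realType.
Implicit Types (f g : R -> R) (x c d t : R).
Local Open Scope classical_set_scope.

Lemma is_derive_near_cst f x df c : is_derive x 1 f df ->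
  (\forall z \near x, f z = c) -> df = 0.
Proof.
move=> [_ <-] e; rewrite (@near_eq_derive _ _ _ _ (cst c))//.
exact: derive_cst.
Qed.

Lemma is_derive_mulB f g x df dg c d : is_derive x 1 f df -> is_derive x 1 g dg ->
  is_derive x 1 (fun z => (f z - c) * (g z - d)) (df * (g x - d) + (f x - c) * dg).
Proof.
move=> fx gx.
have fc : is_derive x 1 (f - cst c) df by apply: is_derive_eq; rewrite subr0.
have gd : is_derive x 1 (g - cst d) dg by apply: is_derive_eq; rewrite subr0.
have h : (f - cst c) x *: dg + (g - cst d) x *: df =
    df * (g x - d) + (f x - c) * dg by rewrite /GRing.scale /= addrC [df * _]mulrC.
exact: is_derive_eq (is_deriveM fc gd) h.
Qed.

Lemma is_derive_precompZ f x t df : is_derive (t * x) 1 f df ->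
  is_derive x 1 (fun z => f (t * z)) (t * df).
Proof.
move=> fx; have tx : is_derive x 1 (t \*: @id R) t.
  by apply: is_derive_eq; rewrite /GRing.scale /= mulr1.
by rewrite mulrC; exact: is_derive1_comp fx tx.
Qed.

Lemma is_derive_scaleB f g x df dg t : is_derive x 1 f df -> is_derive x 1 g dg ->
  is_derive x 1 (fun z => f z - t * g z) (df - t * dg).
Proof.
move=> fx gx; have tg : is_derive x 1 (t \*: g) (t * dg) by exact: is_deriveZ.
exact: is_deriveB.
Qed.

Lemma is_derive_lin f g x df dg (c d : R) : is_derive x 1 f df -> is_derive x 1 g dg ->
  is_derive x 1 (fun z => c * f z + d * g z) (c * df + d * dg).
Proof.
move=> fx gx; have cf : is_derive x 1 (c \*: f) (c * df) by exact: is_deriveZ.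
have dg' : is_derive x 1 (d \*: g) (d * dg) by exact: is_deriveZ.
exact: is_deriveD.
Qed.

Lemma derive0_cst_itv f (r : R) : (forall x, 0 < x < r -> is_derive x 1 f 0) ->
  forall x y, 0 < x < r -> 0 < y < r -> f x = f y.
Proof.
move=> df0 x y; wlog xy : x y / x < y.
  move=> wl xr yr; have [|yx|->//] := ltgtP x y; first by move=> xy; exact: wl.
  by apply/esym; exact: wl.
move=> /andP[x0 xr] /andP[y0 yr].
have itv z : z \in `[x, y]%R -> 0 < z < r.
  by rewrite in_itv /= => /andP[xz zy]; rewrite (lt_le_trans x0 xz) (le_lt_trans zy yr).
have [||z _ fxy] := @MVT _ f (cst 0) x y xy.
- by move=> z /subset_itv_oo_cc/itv; exact: df0.
- apply: derivable_within_continuous => z /itv zr.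
  by have [] := df0 z zr.
by apply/esym/eqP; rewrite -subr_eq0 fxy mul0r.
Qed.

End DerivativeTools.

Section Rigidity.
Variable R : realType.
Local Open Scope classical_set_scope.
Implicit Types (s t x y z : R).
Variables (phi chi : R -> R).
Hypotheses (hphi : C1_pos phi) (hchi : C1_pos chi).
Hypothesis hK : forall t x y, 0 < t < 1 -> 0 < x -> 0 < y -> x + y < 1 ->
  paired_kernel phi chi (t * x) (t * y) = t^-1 * paired_kernel phi chi x y.
Hypothesis hKd : forall x, 0 < x < 2^-1 -> paired_kernel phi chi x x = x^-1.

Let a : R -> R := phi^`().
Let b : R -> R := chi^`().

Let derive_phi x : 0 < x -> is_derive x 1 phi (a x).
Proof. by move=> /hphi[? _]; rewrite /a derive1E; exact: derivableP. Qed.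

Let derive_chi x : 0 < x -> is_derive x 1 chi (b x).
Proof. by move=> /hchi[? _]; rewrite /b derive1E; exact: derivableP. Qed.

Let ab x : 0 < x < 2^-1 -> a x * b x = x^-1.
Proof. by move=> xr; rewrite -hKd// /paired_kernel !ddxx. Qed.

Let a_neq0 x : 0 < x < 2^-1 -> a x != 0.
Proof.
move=> xr; apply/eqP => a0; have := ab xr; rewrite a0 mul0r => /eqP.
by rewrite eq_sym invr_eq0 gt_eqF//; case/andP: xr.
Qed.

(** The kernel has degree -1, so the product of increments has degree 1; the bounds by 1/2 ensure
    [x + y < 1]. *)
Let F_scale t x y : 0 < t < 1 -> 0 < x < 2^-1 -> 0 < y < 2^-1 ->
  (phi (t * x) - phi (t * y)) * (chi (t * x) - chi (t * y)) =
  t * ((phi x - phi y) * (chi x - chi y)).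
Proof.
move=> t01 /andP[x0 x1] /andP[y0 y1]; have /andP[t0 _] := t01.
have := hK t01 x0 y0 ltac:(lra); rewrite /paired_kernel => E.
rewrite !(ddE phi) !(ddE chi) mulrACA E.
by field; rewrite gt_eqF.
Qed.

Lemma mixed_derivative_scale t x y : 0 < t < 1 -> 0 < x < 2^-1 -> 0 < y < 2^-1 ->
  t * (a (t * x) * b (t * y) + a (t * y) * b (t * x)) = a x * b y + a y * b x.
Proof.
move=> t01 xr yr; have /andP[t0 _] := t01.
have near_r z : 0 < z < 2^-1 -> \forall w \near z, 0 < w < 2^-1.
  move=> /andP[z0 z1]; near=> w; apply/andP; split.
    by near: w; exact: lt_nbhsr.
  by near: w; exact: lt_nbhsl.
have dx u : 0 < u < 2^-1 ->
    a (t * x) * (chi (t * x) - chi (t * u)) + (phi (t * x) - phi (t * u)) * b (t * x) =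
    a x * (chi x - chi u) + (phi x - phi u) * b x.
  move=> ur; have /andP[x0 _] := xr.
  have d1 := is_derive_mulB (phi (t * u)) (chi (t * u))
    (is_derive_precompZ (derive_phi (mulr_gt0 t0 x0)))
    (is_derive_precompZ (derive_chi (mulr_gt0 t0 x0))).
  have d2 := is_derive_mulB (phi u) (chi u) (derive_phi x0) (derive_chi x0).
  have := is_derive_near_cst (c := 0) (is_derive_scaleB t d1 d2).
  move=> /(_ _)/eqP; rewrite subr_eq0 => /(_ _)/eqP h.
  apply: (mulfI (lt0r_neq0 t0)); rewrite -h; first by ring.
  by apply: filterS (near_r _ xr) => w wr; rewrite F_scale// subrr.
have /andP[y0 _] := yr; have ty0 := mulr_gt0 t0 y0.
(* For fixed [x], [dx] is an affine relation between values of [phi] and [chi], so it can be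
   differentiated in the other variable using first derivatives only. *)
have d1 := is_derive_lin (b (t * x)) (a (t * x))
  (is_derive_precompZ (derive_phi ty0)) (is_derive_precompZ (derive_chi ty0)).
have d2 := is_derive_lin (b x) (a x) (derive_phi y0) (derive_chi y0).
have := is_derive_near_cst (c := b (t * x) * phi (t * x) + a (t * x) * chi (t * x) -
  (b x * phi x + a x * chi x)) (is_derive_scaleB 1 d1 d2).
have E0 : \forall z \near y, b (t * x) * phi (t * z) + a (t * x) * chi (t * z) -
    1 * (b x * phi z + a x * chi z) =
    b (t * x) * phi (t * x) + a (t * x) * chi (t * x) - (b x * phi x + a x * chi x).
  by apply: filterS (near_r _ yr) => z /dx; lra.
move=> /(_ E0); lra.
Unshelve. all: by end_near. Qed.

(* u = a(s x) / a(x) solves u + 1/(s u) = const: if it took two values, their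
   mean would be a third root. *)
Let ratio_cst s : 0 < s < 1 -> exists m, forall x, 0 < x < 2^-1 -> a (s * x) = m * a x.
Proof.
move=> s01; have /andP[s0 s1] := s01.
have sr x : 0 < x < 2^-1 -> 0 < s * x < 2^-1.
  by move=> /andP[x0 x1]; rewrite mulr_gt0//= (lt_trans _ x1)// gtr_pMl.
pose u x := a (s * x) / a x.
have u0 x : 0 < x < 2^-1 -> u x != 0.
  by move=> xr; rewrite mulf_neq0 ?invr_neq0 ?a_neq0// sr.
have uE x y : 0 < x -> x < y -> y < 2^-1 -> u x + (s * u x)^-1 = u y + (s * u y)^-1.
  move=> x0 xy y1; have y0 := lt_trans x0 xy; have yr : 0 < y < 2^-1 by rewrite y0.
  have xr : 0 < x < 2^-1 by rewrite x0 (lt_trans xy).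
  (* At the pair [(y, s y)] this factor leads to [(x, s x)]: the mixed derivative relates [u x] to
     [u y]. *)
  have t01 : 0 < x / y < 1 by rewrite divr_gt0//= ltr_pdivrMr// mul1r.
  have := mixed_derivative_scale t01 yr (sr _ yr).
  rewrite mulrCA divfK ?gt_eqF// => E.
  have bE z : 0 < z < 2^-1 -> b z = (z * a z)^-1.
    move=> zr; apply: (mulfI (a_neq0 zr)); rewrite ab// invfM mulrCA divff ?mulr1//.
    exact: a_neq0.
  have Ux z : 0 < z < 2^-1 -> z * (a z * b (s * z) + a (s * z) * b z) = u z + (s
    * u z)^-1.
    move=> zr; rewrite !bE ?sr// /u.
    have := a_neq0 zr; have := a_neq0 (sr _ zr); have /andP[z0 _] := zr.
    by move=> h1 h2; field; rewrite h1 h2 !gt_eqF.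
  rewrite -(Ux x)// -(Ux y)// -E mulrA; congr (_ * _).
  by rewrite mulrCA divff ?mulr1// gt_eqF.
have ucst x y : 0 < x -> x < y -> y < 2^-1 -> u x = u y.
  move=> x0 xy y1; apply/eqP; apply: contraT => uxy.
  have itv z : z \in `[x, y]%R -> 0 < z < 2^-1.
    by rewrite in_itv /= => /andP[xz zy]; rewrite (lt_le_trans x0 xz)
      (le_lt_trans zy y1).
  have uc : {within `[x, y], continuous u}.
    apply: continuous_in_subspaceT => z /[1!inE] /itv zr; have /andP[z0 _] := zr.
    have az : {for z, continuous a} by have [_] := hphi z0.
    have asz : {for s * z, continuous a} by have [_] := hphi (mulr_gt0 s0 z0).
    have sz : s * w @[w --> z] --> s * z by apply: cvgM; [exact: cvg_cst|exact: cvg_id].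
    apply: (cvgM (cvg_comp _ _ sz asz)); apply: cvgV => //; exact: a_neq0.
  have [|z zr uz] := IVT (v := (u x + u y) / 2) (ltW xy) uc.
    by rewrite ge_min le_max; have [?|?] := leP (u x) (u y); apply/andP; split;
      apply/orP; [left|right|right|left]; lra.
  have xr : 0 < x < 2^-1 by rewrite x0 (lt_trans xy).
  have yr : 0 < y < 2^-1 by rewrite (lt_trans x0 xy).
  have uxE := uE x y x0 xy y1.
  have uzE : u z + (s * u z)^-1 = u y + (s * u y)^-1.
    have := itv z zr; move: zr; rewrite in_itv /= le_eqVlt => /andP[_].
    rewrite le_eqVlt => /predU1P[->//|zy] /andP[z0 _].
    exact: uE.
  (* Two distinct roots satisfy [s A B = 1]; paired with [u y], both [u x] and [u z] would then be
     the same root. *)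
  have key A B : A != 0 -> B != 0 -> A != B ->
      A + (s * A)^-1 = B + (s * B)^-1 -> s * A * B = 1.
    move=> A0 B0 AB eAB; apply/eqP; rewrite -subr_eq0; apply/eqP.
    apply: (mulfI (_ : A - B != 0)); first by rewrite subr_eq0.
    rewrite mulr0 -[RHS](mulr0 (s * A * B)).
    have /eqP := eAB; rewrite -subr_eq0 => /eqP <-.
    by field; rewrite A0 B0 gt_eqF.
  have zx : u z != u x by rewrite uz; apply: contra uxy => /eqP h; apply/eqP; lra.
  have zy : u z != u y by rewrite uz; apply: contra uxy => /eqP h; apply/eqP; lra.
  have h1 := key _ _ (u0 _ xr) (u0 _ yr) uxy uxE.
  have h2 := key _ _ (u0 _ (itv z zr)) (u0 _ yr) zy uzE.
  case/eqP: zx; apply: (mulfI (lt0r_neq0 s0)); apply: (mulIf (u0 _ yr)).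
  by rewrite h2 h1.
exists (u 4^-1) => x xr; have q0 : 0 < (4 : R)^-1 by lra.
have q1 : (4 : R)^-1 < 2^-1 by lra.
have /andP[x0 x1] := xr.
have -> : u 4^-1 = u x by have [xq|qx|->//] := ltgtP x 4^-1; [apply/esym|]; exact: ucst.
by rewrite /u divfK// a_neq0.
Qed.

Lemma rigidity_derivative : exists C p : R, C != 0 /\
  forall x, 0 < x < 2^-1 -> a x = C * x `^ (p - 1) /\ b x = C^-1 * x `^ (- p).
Proof.
(* Arbitrary base points of (0, 1/2). The increment [D] is nonzero because [phi'] has no zero
   there. *)
pose x1 : R := 4^-1; pose y1 : R := 8^-1.
have x1r : 0 < x1 < 2^-1 by rewrite /x1; lra.
have y1r : 0 < y1 < 2^-1 by rewrite /y1; lra.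
pose D := phi x1 - phi y1; pose E := x1 * a x1 - y1 * a y1.
have D0 : D != 0.
  have yx : y1 < x1 by rewrite /y1 /x1; lra.
  have itv z : z \in `[y1, x1]%R -> 0 < z < 2^-1.
    by rewrite in_itv /= => /andP[yz zx]; move: yz zx; rewrite /y1 /x1; lra.
  have [||z /subset_itv_oo_cc/itv zr E0] := @MVT _ phi a y1 x1 yx.
  - by move=> z /subset_itv_oo_cc/itv/andP[z0 _]; exact: derive_phi.
  - apply: derivable_within_continuous => z /itv/andP[z0 _].
    by have [] := derive_phi z0.
  by rewrite /D E0 mulf_neq0 ?a_neq0// subr_eq0 gt_eqF.
(* The ratio [m] depends on [s] in an unknown way; comparison with the base increment eliminates
   it. *)
have scale s x y : 0 < s < 1 -> 0 < x < 2^-1 -> 0 < y < 2^-1 ->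
    (phi (s * x) - phi (s * y)) * D = (phi (s * x1) - phi (s * y1)) * (phi x - phi y).
  move=> s01 xr yr; have /andP[s0 _] := s01; have [m mE] := ratio_cst s01.
  have dphi z : 0 < z < 2^-1 -> is_derive z 1 (fun z => phi (s * z) - (s * m) *
    phi z) 0.
    move=> zr; have /andP[z0 _] := zr.
    have := is_derive_scaleB (s * m) (is_derive_precompZ (derive_phi (mulr_gt0 s0
      z0))) (derive_phi z0).
    by rewrite mE// mulrA subrr.
  have cst := derive0_cst_itv dphi.
  have -> : phi (s * x) - phi (s * y) = s * m * (phi x - phi y) by have := cst _
    _ xr yr; lra.
  have -> : phi (s * x1) - phi (s * y1) = s * m * D by have := cst _ _ x1r y1r;
    rewrite /D; lra.
  by ring.
(* [scale] is differentiated in [s]. As only [s < 1] is available, this is done at 1/2 instead of 1,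
   and the ratio [m] there cancels. *)
have ode x y : 0 < x < 2^-1 -> 0 < y < 2^-1 ->
    (x * a x - y * a y) * D = E * (phi x - phi y).
  move=> xr yr; have s01 : 0 < (2 : R)^-1 < 1 by lra.
  have [m mE] := ratio_cst s01.
  have m0 : m != 0.
    apply/eqP => m0; have := mE _ x1r; rewrite m0 mul0r => /eqP; apply/negP.
    by apply: a_neq0; rewrite /x1; lra.
  have ds z : 0 < z -> is_derive (2^-1 : R) 1 (fun s => phi (s * z)) (z * a (2^-1 * z)).
    move=> z0; have h : 0 < z * 2^-1 by rewrite divr_gt0.
    have := is_derive_precompZ (derive_phi h); rewrite [in a _]mulrC.
    by under eq_fun do rewrite mulrC.
  have /andP[x0 _] := xr; have /andP[y0 _] := yr.
  have /andP[x10 _] := x1r; have /andP[y10 _] := y1r.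
  have d1 := is_derive_lin D (- D) (ds _ x0) (ds _ y0).
  have d2 := is_derive_lin (phi x - phi y) (- (phi x - phi y)) (ds _ x10) (ds _ y10).
  have := is_derive_near_cst (c := 0) (is_derive_scaleB 1 d1 d2).
  have E0 : \forall s \near (2^-1 : R), D * phi (s * x) + - D * phi (s * y) -
      1 * ((phi x - phi y) * phi (s * x1) + - (phi x - phi y) * phi (s * y1)) = 0.
    near=> s; have s01' : 0 < s < 1.
      apply/andP; split.
        by near: s; apply: lt_nbhsr; case/andP: s01.
      by near: s; apply: lt_nbhsl; case/andP: s01.
    by have := scale s x y s01' xr yr; lra.
  move=> /(_ E0); rewrite !mE// => h; apply: (mulfI m0).
  by rewrite /E; lra.
pose p := E / D.
(* By [ode], [z * a z] is affine in [phi], hence derivable although [a] is only known to be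
   continuous. *)
have xa x : 0 < x < 2^-1 -> is_derive x 1 (fun z => z * a z) (p * a x).
  move=> xr; have /andP[x0 x2] := xr.
  have := is_derive_lin p (y1 * a y1 - p * phi y1) (derive_phi x0) (is_derive_cst
    (1 : R) x 1).
  rewrite mulr0 addr0; apply: near_eq_is_derive.
  near=> z; have zr : 0 < z < 2^-1.
    by apply/andP; split; near: z; [exact: lt_nbhsr|exact: lt_nbhsl].
  apply: (mulIf D0); have := ode z y1 zr y1r; rewrite mulrBl => /eqP.
  rewrite subr_eq => /eqP ->; rewrite /p /cst/=; field.
  exact: D0.
pose g x := x * a x * x `^ (- p).
have gc : forall x y, 0 < x < 2^-1 -> 0 < y < 2^-1 -> g x = g y.
  apply: derive0_cst_itv => x xr; have /andP[x0 _] := xr.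
  have := is_derive_mulB 0 0 (xa _ xr) (is_derive1_powR (- p) x0).
  rewrite !subr0; under eq_fun do rewrite !subr0.
  rewrite (_ : _ + _ = 0)//.
  have -> : x `^ (- p) = x `^ (- p - 1) * x.
    by rewrite -[in X in _ = _ * X](powRr1 (ltW x0)) -powRD ?(gt_eqF x0)
      ?implybT// subrK.
  ring.
exists (g x1), p; split.
  have /andP[x10 _] := x1r.
  by rewrite !mulf_neq0 ?a_neq0 ?powR_ne0// gt_eqF.
move=> x xr; have /andP[x0 _] := xr; rewrite (gc _ _ x1r xr) /g.
have aE : a x = x * a x * x `^ (- p) * x `^ (p - 1).
  rewrite -mulrA -powRD ?(gt_eqF x0) ?implybT// addrA addNr sub0r powR_inv1 ?ltW//.
  by rewrite mulrAC divff ?mul1r// gt_eqF.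
split=> //; apply: (mulfI (a_neq0 xr)); rewrite ab// invfM invfM.
have X0 := powR_ne0 (- p) x0; have A0 := a_neq0 xr.
by field; rewrite X0 A0 gt_eqF.
Unshelve. all: by end_near. Qed.

End Rigidity.

Section Primitives.
Variable R : realType.
Implicit Types (p q t c x y : R).

(** A primitive of [x ^ (q - 1)] for every [q], so that powers and the logarithm form one family. *)
Definition prim q : R -> R := if q == 0 then @ln R else power_fun q.

Lemma is_derive_prim q x : 0 < x -> is_derive x 1 (prim q) (x `^ (q - 1)).
Proof.
move=> x0; rewrite /prim; case: eqVneq => [->|q0]; last exact: is_derive_power_fun.
by rewrite sub0r powR_inv1 ?ltW//; exact: is_derive1_ln.
Qed.

Lemma dd_prim_scale q c x y : 0 < c -> 0 < x -> 0 < y ->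
  dd (prim q) (c * x) (c * y) = c `^ (q - 1) * dd (prim q) x y.
Proof.
move=> c0 x0 y0; rewrite /prim; case: eqVneq => [->|q0]; last exact: dd_power_fun_scale.
rewrite sub0r powR_inv1 ?ltW//.
by have := log_kernel_scale c0 x0 y0; rewrite /paired_kernel !dd_id !mul1r.
Qed.

Lemma prim_kernel_scale p c x y : 0 < c -> 0 < x -> 0 < y ->
  paired_kernel (prim p) (prim (1 - p)) (c * x) (c * y) =
  c^-1 * paired_kernel (prim p) (prim (1 - p)) x y.
Proof.
move=> c0 x0 y0; rewrite /paired_kernel !dd_prim_scale// mulrACA -powRD; last first.
  by rewrite (gt_eqF c0) ?implybT.
by rewrite (_ : p - 1 + _ = -1) ?powR_inv1 ?ltW//; ring.
Qed.

(* For p > 2 the kernel at (1, t) grows like t^(p-2). *)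
Lemma power_kernel_le1 p : p != 0 -> p != 1 ->
  (forall t, 1 < t -> paired_kernel (power_fun p) (power_fun (1 - p)) 1 t <= 1) ->
  p <= 2.
Proof.
move=> p0 p1 le1; rewrite leNgt; apply/negP => p2.
(* A kernel at most 1 would force [t ^ p <= 2 p (p-1) t ^ 2 + 1], below [B t ^ 2]. The choice of [t]
   makes [t ^ (p-2) >= B], and its summand 2 makes the factor [1 - t / t ^ p] at least 1/2. *)
pose B := 2 * p * (p - 1) + 2.
have pp0 : 0 < p * (p - 1) by rewrite mulr_gt0//; lra.
have B0 : 0 < B by rewrite /B; lra.
pose t := B `^ (p - 2)^-1 + 2.
have t2 : 2 <= t by rewrite /t lerDr powR_ge0.
have t0 : 0 < t by lra.
have tp : B <= t `^ (p - 2).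
  have -> : B = (B `^ (p - 2)^-1) `^ (p - 2).
    by rewrite -powRrM mulVf ?powRr1 ?ltW// gt_eqF// subr_gt0.
  apply: ge0_ler_powR; rewrite ?nnegrE ?powR_ge0 ?(ltW t0)//; first by lra.
  by rewrite /t lerDl.
have tpE : t `^ p = t ^+ 2 * t `^ (p - 2).
  rewrite -(powR_mulrn 2 (ltW t0)) -powRD ?(gt_eqF t0) ?implybT//.
  by congr powR; ring.
have X0 : t * 2 <= t `^ p.
  rewrite tpE expr2 -mulrA ler_pM2l//.
  have : 1 <= t `^ (p - 2) by apply: le_trans tp; rewrite /B; lra.
  by move=> h; apply: (le_trans _ (ler_wpM2l (ltW t0) h)); rewrite mulr1.
have Xpos : 0 < t `^ p by exact: powR_gt0.
have := le1 t ltac:(lra); rewrite power_kernelE//; last by rewrite gt_eqF//; lra.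
have half : t / t `^ p <= 2^-1 by rewrite ler_pdivrMr//; lra.
have -> : (1 - t `^ p) * (1 - t / t `^ p) / (p * (1 - p) * (t - 1) ^+ 2) =
   (t `^ p - 1) * (1 - t / t `^ p) / (p * (p - 1) * (t - 1) ^+ 2).
  have h1 : t - 1 != 0 by rewrite gt_eqF//; lra.
  have h2 : p - 1 != 0 by rewrite subr_eq0.
  have h3 : 1 - p != 0 by rewrite subr_eq0 eq_sym.
  by field; rewrite p0 h1 h2 h3 gt_eqF.
have t10 : 0 < (t - 1) ^+ 2 by rewrite exprn_gt0// subr_gt0; lra.
rewrite (ler_pdivrMr _ _ (mulr_gt0 pp0 t10)) mul1r => le.
have le' : (t `^ p - 1) * 2^-1 <= p * (p - 1) * (t - 1) ^+ 2.
  by apply: le_trans le; rewrite ler_wpM2l//; lra.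
have Bt : B * t ^+ 2 <= t `^ p by rewrite tpE mulrC ler_wpM2l// exprn_ge0// ltW.
have sq : (t - 1) ^+ 2 <= t ^+ 2 by rewrite ler_pXn2r ?nnegrE//; lra.
have := ler_wpM2l (ltW pp0) sq.
have t21 : 1 < t ^+ 2 by rewrite expr_gt1 ?ltW//; lra.
rewrite /B in Bt; nra.
Qed.

Lemma power_kernel_range p : p != 0 -> p != 1 ->
  (forall t, 1 < t -> paired_kernel (power_fun p) (power_fun (1 - p)) 1 t <= 1) ->
  -1 <= p <= 2.
Proof.
move=> p0 p1 le1; rewrite (power_kernel_le1 p0 p1 le1) andbT.
suff : 1 - p <= 2 by lra.
apply: power_kernel_le1; rewrite ?subr_eq0 1?eq_sym//.
  by rewrite -subr_eq0 opprB addrCA subrr addr0.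
move=> t t1; rewrite (_ : 1 - (1 - p) = p); last by ring.
by rewrite /paired_kernel mulrC; exact: le1.
Qed.

End Primitives.

Lemma continuous_cst_left (R : realType) (h : R -> R) (c : R) :
  {for 1, continuous h} -> (forall x, 0 < x < 1 -> h x = c) -> h 1 = c.
Proof.
move=> hc hE; have hl : (h x @[x --> (1 : R)^'-] --> h 1)%classic by exact:
  cvg_at_left_filter.
have hc' : (h x @[x --> (1 : R)^'-] --> c)%classic.
  apply: cvg_trans (@cvg_cst _ c _ (at_left 1) _); apply: near_eq_cvg.
  near=> x; rewrite /cst hE//; apply/andP; split; last by [].
  by near: x; apply: nbhs_left_gt.
exact: norm_cvg_unique hl hc'.
Unshelve. all: by end_near. Qed.

(** * From (0, 1/2) to (0, 1] *)

Section FullRigidity.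
Variable R : realType.
Implicit Types (s t x y z : R).
Variables (phi chi : R -> R).
Hypotheses (hphi : C1_pos phi) (hchi : C1_pos chi).
Hypothesis hK : forall t x y, 0 < t < 1 -> 0 < x -> 0 < y -> x + y < 1 ->
  paired_kernel phi chi (t * x) (t * y) = t^-1 * paired_kernel phi chi x y.
Hypothesis hKd : forall x, 0 < x < 2^-1 -> paired_kernel phi chi x x = x^-1.

Let rigid_half : exists C p B1 B2 : R, C != 0 /\
  forall x, 0 < x < 2^-1 -> phi x = C * prim p x + B1 /\
    chi x = C^-1 * prim (1 - p) x + B2.
Proof.
have [C [p [C0 hC]]] := rigidity_derivative hphi hchi hK hKd.
have qr : 0 < (4^-1 : R) < 2^-1 by lra.
exists C, p, (phi 4^-1 - C * prim p 4^-1), (chi 4^-1 - C^-1 * prim (1 - p) 4^-1).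
split=> // x xr.
have d1 z : 0 < z < 2^-1 -> is_derive z 1 (fun z => phi z - C * prim p z) 0.
  move=> zr; have [az _] := hC z zr; have /andP[z0 _] := zr.
  have dphi : is_derive z 1 phi (phi^`() z)%classic.
    by have [? _] := hphi z0; rewrite derive1E; exact: derivableP.
  have := is_derive_scaleB C dphi (is_derive_prim p z0).
  by rewrite az subrr.
have d2 z : 0 < z < 2^-1 -> is_derive z 1 (fun z => chi z - C^-1 * prim (1 - p) z) 0.
  move=> zr; have [_ bz] := hC z zr; have /andP[z0 _] := zr.
  have dchi : is_derive z 1 chi (chi^`() z)%classic.
    by have [? _] := hchi z0; rewrite derive1E; exact: derivableP.
  have := is_derive_scaleB C^-1 dchi (is_derive_prim (1 - p) z0).
  by rewrite bz (_ : 1 - p - 1 = - p) ?subrr//; ring.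
have e1 := derive0_cst_itv d1 xr qr; have e2 := derive0_cst_itv d2 xr qr.
by split; lra.
Qed.

Lemma rigidity : exists C p B1 B2 : R, C != 0 /\
  forall x, 0 < x <= 1 -> phi x = C * prim p x + B1 /\
    chi x = C^-1 * prim (1 - p) x + B2.
Proof.
have [C [p [B1 [B2 [C0 half]]]]] := rigid_half.
exists C, p, B1, B2; split=> //.
pose r := prim p; pose q := prim (1 - p).
(* Halving brings [x] and [y] into (0, 1/2), where the formulas are known; homogeneity of both
   kernels carries the equality back. *)
have phiE x y : 0 < x -> 0 < y -> x + y < 1 -> x != y ->
    (phi x - phi y) * (chi x - chi y) = (r x - r y) * (q x - q y).
  move=> x0 y0 xy1 xy; have s01 : 0 < (2 : R)^-1 < 1 by lra.
  have sx : 0 < 2^-1 * x < 2^-1 by lra.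
  have sy : 0 < 2^-1 * y < 2^-1 by lra.
  have sxy : 2^-1 * x != 2^-1 * y by apply: contra xy => /eqP h; apply/eqP; lra.
  have := hK s01 x0 y0 xy1; have := @prim_kernel_scale _ p 2^-1 x y ltac:(lra) x0 y0.
  have -> : paired_kernel phi chi (2^-1 * x) (2^-1 * y) =
      paired_kernel (prim p) (prim (1 - p)) (2^-1 * x) (2^-1 * y).
    have [fx gx] := half _ sx; have [fy gy] := half _ sy.
    rewrite /paired_kernel !(dd_neq _ sxy) fx fy gx gy.
    have d0 : 2^-1 * x - 2^-1 * y != 0 by rewrite subr_eq0.
    by move: d0; set d := 2^-1 * x - _ => d0; field; rewrite d0 C0.
  move=> -> E; rewrite !(ddE phi) !(ddE chi) !(ddE r) !(ddE q).
  rewrite [LHS]mulrACA [RHS]mulrACA; congr (_ * _).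
  by apply/esym; apply: mulfI E; rewrite invr_eq0 invr_eq0.
have open x : 0 < x < 1 -> phi x = C * r x + B1 /\ chi x = C^-1 * q x + B2.
  move=> /andP[x0 x1]; have [xh|hx] := ltP x 2^-1; first by apply: half; rewrite x0.
  (* The defects at [x]. Pairing [x] with the points [y < 1 - x], where the formulas hold, gives
     [E]; its derivative in [y] is [dE]. *)
  pose P := phi x - (C * r x + B1); pose Q := chi x - (C^-1 * q x + B2).
  have E y : 0 < y < 1 - x -> P * C^-1 * (q x - q y) + Q * C * (r x - r y) = - (P * Q).
    move=> /andP[y0 y1]; have xy : x != y by rewrite gt_eqF//; lra.
    have := phiE x y x0 y0 ltac:(lra) xy.
    have [-> ->] := half y ltac:(lra).
    have -> : phi x = P + (C * r x + B1) by rewrite /P; ring.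
    have -> : chi x = Q + (C^-1 * q x + B2) by rewrite /Q; ring.
    have CC : C * C^-1 = 1 by rewrite divff.
    have e : (P + C * (r x - r y)) * (Q + C^-1 * (q x - q y)) = P * Q +
        (P * C^-1 * (q x - q y) + Q * C * (r x - r y)) + C * C^-1 * ((r x - r y)
          * (q x - q y)).
      by ring.
    by move: e; rewrite CC /r /q; lra.
  have dE y : 0 < y < 1 - x -> P * C^-1 + Q * C * y `^ (2 * p - 1) = 0.
    move=> /andP[y0 y1].
    have := is_derive_near_cst (c := P * Q + P * C^-1 * q x + Q * C * r x)
      (is_derive_lin (P * C^-1) (Q * C) (is_derive_prim (1 - p) y0)
        (is_derive_prim p y0)).
    move=> /(_ _) h; have {}h : P * C^-1 * y `^ (1 - p - 1) + Q * C * y `^ (p - 1) = 0.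
      apply: h; near=> z.
      have zr : 0 < z < 1 - x.
        by apply/andP; split; near: z; [exact: lt_nbhsr|exact: lt_nbhsl].
      have := E z zr; rewrite /r /q; lra.
    have Y0 := powR_ne0 p y0; apply: (mulIf (invr_neq0 Y0)); rewrite mul0r -h.
    have -> : 2 * p - 1 = p + (p - 1) by ring.
    have -> : 1 - p - 1 = - p by ring.
    rewrite powRD ?(gt_eqF y0) ?implybT// powRN.
    by field; rewrite C0 Y0.
  have PQ : P = 0 /\ Q = 0.
    have e1 : 0 < (1 - x) / 2 < 1 - x by lra.
    (* For [p = 1/2] the power in [dE] is constant and gives one relation only; but then [q = r],
       and [E] adds [P * Q = 0]. *)
    have [p2|p2] := eqVneq (2 * p - 1) 0.
      have := dE _ e1; rewrite p2 powRr0 mulr1 => h.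
      have := E _ e1; have -> : q = r by rewrite /q /r; congr prim; lra.
      rewrite -mulrDl h mul0r => /esym/eqP; rewrite oppr_eq0 mulf_eq0.
      move=> /orP[]/eqP z0; move: h; rewrite z0.
        rewrite mul0r add0r => /eqP; rewrite mulf_eq0 (negPf C0) orbF => /eqP Q0.
        by split.
      rewrite mul0r addr0 => /eqP; rewrite mulf_eq0 invr_eq0 (negPf C0) orbF => /eqP.
      by move=> ->.
    (* Two points of ratio 2 separate the constant from the nonconstant power in [dE]. *)
    have e2 : 0 < (1 - x) / 4 < 1 - x by lra.
    have y0 : 0 < (1 - x) / 4 by lra.
    have h1 := dE _ e1; have h2 := dE _ e2.
    have yE : ((1 - x) / 2) `^ (2 * p - 1) = 2 `^ (2 * p - 1) * ((1 - x) / 4) `^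
      (2 * p - 1).
      by rewrite -powRM ?(ltW y0)//; congr powR; field.
    have Q0 : Q = 0.
      have : Q * C * ((1 - x) / 4) `^ (2 * p - 1) * (2 `^ (2 * p - 1) - 1) = 0.
        by move: h1 h2; rewrite yE; nra.
      move/eqP; rewrite !mulf_eq0 (negPf C0) (negPf (powR_ne0 _ y0)) !orbF [_ - 1
        == 0]subr_eq0.
      have two1 : (2 == 1 :> R) = false by rewrite gt_eqF// ltr1n.
      have two0 : (2 < 0 :> R) = false by rewrite ltNge ler0n.
      by rewrite powR_eq1 (negPf p2) two1 two0 !orbF => /eqP.
    split=> //; move: h1; rewrite Q0 !mul0r addr0 => /eqP.
    by rewrite mulf_eq0 invr_eq0 (negPf C0) orbF => /eqP.
  by case: PQ; rewrite /P /Q => P0 Q0; split; lra.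
(* No [y > 0] satisfies [1 + y < 1], so the point 1 is reached by continuity. *)
move=> x /andP[x0]; rewrite le_eqVlt => /predU1P[->|x1]; last by apply: open;
  rewrite x0.
have cphi (f : R -> R) : C1_pos f -> {for 1, continuous f}%classic.
  by move=> /(_ 1 ltr01)[/derivable1_diffP/differentiable_continuous].
have cprim q' : {for 1, continuous (prim q')}%classic.
  exact: continuous_is_derive (is_derive_prim q' ltr01).
have cont (f : R -> R) (c B q' : R) : C1_pos f ->
    (forall x, 0 < x < 1 -> f x = c * prim q' x + B) -> f 1 = c * prim q' 1 + B.
  move=> fc fE; apply/eqP; rewrite -subr_eq0; apply/eqP.
  apply: (@continuous_cst_left _ (fun x => f x - (c * prim q' x + B))) => [|z zr].
    apply: cvgB; first exact: cphi.
    apply: cvgD; last exact: cvg_cst.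
    by apply: cvgM; [exact: cvg_cst|exact: cprim].
  by rewrite fE// subrr.
by split; apply: cont => // z zr; have [] := open z zr.
Unshelve. all: by end_near. Qed.

End FullRigidity.

(** * Equivalent pairs and the classification *)

(** With [x < 1] the relation, given on (0, 1], holds in a neighbourhood of [x] and passes to the
    derivative. *)
Lemma dd_affine (R : realType) (f g : R -> R) (a b x y : R) :
  derivable f x 1 -> 0 < x < 1 -> 0 < y < 1 ->
  (forall z, 0 < z <= 1 -> g z = a * f z + b) -> dd g x y = a * dd f x y.
Proof.
move=> df /andP[x0 x1] /andP[y0 y1] gE; have [<-|xy] := eqVneq x y; last first.
  rewrite !(dd_neq _ xy) !gE ?x0 ?y0 ?ltW//.
  by rewrite opprD addrACA subrr addr0 -mulrBr mulrA.
have dfx : is_derive x 1 f (dd f x x) by rewrite ddxx derive1E; exact: derivableP.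
apply: dd_is_derive.
have := is_derive_lin a b dfx (is_derive_cst (1 : R) x 1).
rewrite mulr0 addr0; apply: near_eq_is_derive; near=> z.
rewrite /cst /= mulr1 gE//; apply/andP; split; near: z; first exact: lt_nbhsr.
by apply: filterS (lt_nbhsl x1) => z /ltW.
Unshelve. all: by end_near. Qed.

Lemma paired_kernel_equiv (R : realType) (phi0 chi0 phi chi : R -> R) (x y : R) :
  (forall x, 0 < x -> derivable phi0 x 1) -> (forall x, 0 < x -> derivable chi0 x 1) ->
  pair_equiv phi0 chi0 phi chi -> 0 < x < 1 -> 0 < y < 1 ->
  paired_kernel phi chi x y = paired_kernel phi0 chi0 x y.
Proof.
move=> dphi dchi [A1 [A2 [B1 [B2 [A12 E]]]]] xr yr; have /andP[x0 _] := xr.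
rewrite /paired_kernel (dd_affine (dphi x x0) xr yr (fun z zr => (E z zr).1)).
rewrite (dd_affine (dchi x x0) xr yr (fun z zr => (E z zr).2)).
by rewrite mulrACA A12 mul1r.
Qed.

(** Stated through the kernel, which is symmetric in the two functions, to serve both orders of the
    pair. *)
Lemma induces_log (R : realType) (phi chi : R -> R) :
  (forall x, 0 < x -> derivable phi x 1) -> (forall x, 0 < x -> derivable chi x 1) ->
  (forall x y, 0 < x < 1 -> 0 < y < 1 ->
     paired_kernel phi chi x y = paired_kernel (@id R) (@ln R) x y) ->
  induces_paired_monotone_metric phi chi.
Proof.
move=> dphi dchi E.
apply: (@induces_paired_of_kernel _ _ _ (paired_kernel (@id R) (@ln R))) => //.
- exact: log_kernel_scale.
- exact: paired_kernelC.
- exact: stieltjes_log_kernel.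
- exact: log_kernel11.
Qed.

Lemma chentsov_morozova_scale (R : realType) (f : R -> R) (t x y : R) :
  0 < t -> 0 < y ->
  chentsov_morozova f (t * x) (t * y) = t^-1 * chentsov_morozova f x y.
Proof.
move=> t0 y0; rewrite /chentsov_morozova !div1r -mulf_div divff ?mul1r ?gt_eqF//.
by rewrite -mulrA invfM.
Qed.

Theorem theorem5p1 (R : realType) (phi chi : R -> R)
    (hphi : C1_pos phi) (hchi : C1_pos chi) :
  induces_paired_monotone_metric phi chi <->
  (exists p : R, [/\ -1 <= p <= 2, p != 0, p != 1 &
     pair_equiv (fun x => powR x p / p) (fun x => powR x (1 - p) / (1 - p))
       phi chi]) \/
  (* the pair (x, log x) is taken up to exchanging its two members *)
  (pair_equiv (fun x => x) (fun x => ln x) phi chi \/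
   pair_equiv (fun x => x) (fun x => ln x) chi phi).
Proof.
have dphi x : 0 < x -> derivable phi x 1 by move=> /hphi[].
have dchi x : 0 < x -> derivable chi x 1 by move=> /hchi[].
have did x : 0 < x -> derivable (@id R) x 1 by [].
split; last first.
  case=> [[p [p12 p0 p1 pe]]|[pe|pe]].
  - have p10 : 1 - p != 0 by rewrite subr_eq0 eq_sym.
    have E x y : 0 < x < 1 -> 0 < y < 1 -> paired_kernel phi chi x y =
        paired_kernel (power_fun p) (power_fun (1 - p)) x y.
      by apply: paired_kernel_equiv pe => z z0; exact: derivable_power_fun.
    apply: (@induces_paired_of_kernel _ _ _
      (paired_kernel (power_fun p) (power_fun (1 - p)))) => //.
    + by move=> c x y; exact: power_kernel_scale.
    + exact: paired_kernelC.
    + exact: stieltjes_power_kernel.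
    + exact: power_kernel11.
  - apply: induces_log => // x y; apply: (paired_kernel_equiv did _ pe) => z.
    exact: derivable_ln_gt0.
  - apply: induces_log => // x y xr yr; rewrite /paired_kernel mulrC.
    apply: (paired_kernel_equiv did _ pe xr yr) => z; exact: derivable_ln_gt0.
move=> [f [fm fs f1 metric]].
have KE x y : 0 < x -> 0 < y -> x + y < 1 ->
    paired_kernel phi chi x y = chentsov_morozova f x y.
  exact: paired_metric_kernel dphi dchi fs (metric 3%N).
have [|x xr|C [p [B1 [B2 [C0 E]]]]] := rigidity hphi hchi.
- move=> t x y /andP[t0 t1] x0 y0 xy1; rewrite !KE ?mulr_gt0//.
    exact: chentsov_morozova_scale.
  by rewrite -mulrDr (lt_trans _ xy1)// gtr_pMl// addr_gt0.
- rewrite KE; [|lra..].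
  rewrite /chentsov_morozova divff ?f1 ?mulr1 ?div1r// gt_eqF//; lra.
(* Here [phi] is the logarithm up to constants, so the pair appears exchanged. *)
have [p0|p0] := eqVneq p 0.
  right; right; exists C^-1, C, B2, B1; split; first by rewrite mulVf.
  move=> x xr; have [-> ->] := E x xr; rewrite p0 subr0 /prim eqxx oner_eq0.
  by rewrite /power_fun powRr1 ?divr1// ltW//; case/andP: xr.
have [p1|p1] := eqVneq p 1.
  right; left; exists C, C^-1, B1, B2; split; first by rewrite divff.
  move=> x xr; have [-> ->] := E x xr; rewrite p1 subrr /prim eqxx oner_eq0.
  by rewrite /power_fun powRr1 ?divr1// ltW//; case/andP: xr.
have p10 : 1 - p != 0 by rewrite subr_eq0 eq_sym.
have primE (q : R) : q != 0 -> prim q = power_fun q by rewrite /prim => /negPf->.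
have pe : pair_equiv (power_fun p) (power_fun (1 - p)) phi chi.
  exists C, C^-1, B1, B2; split; first by rewrite divff.
  by move=> x xr; rewrite -(primE p p0) -(primE _ p10); exact: E.
left; exists p; split=> //; apply: power_kernel_range => // t t1.
(* The pair [(t, 1)] scaled by [y] has sum [(t + 1) / (t + 2) < 1], within reach of the kernel
   identity. *)
pose y := (t + 2)^-1.
have y0 : 0 < y by rewrite invr_gt0; lra.
have y3 : y * (t + 2) = 1 by rewrite mulVf// gt_eqF//; lra.
have t0 : 0 < t by lra.
have yt : 0 < y * t by rewrite mulr_gt0.
have ft : 1 <= f t by rewrite -f1; exact: operator_monotone_le.
have := KE (y * t) (y * 1) yt ltac:(lra) ltac:(lra).
rewrite chentsov_morozova_scale//.
rewrite (paired_kernel_equiv (fun z => @derivable_power_fun _ _ z p0)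
  (fun z => @derivable_power_fun _ _ z p10) pe); [|lra..].
rewrite power_kernel_scale// => /(mulfI _) => /(_ _); rewrite paired_kernelC => ->.
  by rewrite /chentsov_morozova !mul1r divr1 invf_le1// (lt_le_trans ltr01).
by rewrite invr_eq0 gt_eqF.
Qed.
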